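(* Let $N\ge2$ and $1<p<N$. The problem $$-\Delta_p u=\frac1u\ \text{ in }\mathbb{R}^N_+,\qquad u>0\ \text{ in }\mathbb{R}^N_+,\qquad u=0\ \text{ on }\partial\mathbb{R}^N_+$$ has no weak solution $u\in W^{1,p}_{\rm loc}(\mathbb{R}^N_+)$ (in the sense given in the context) such that $u\in L^\infty(\Sigma_{\overline\lambda})$ for some $\overline\lambda>0$.
   Context: $\mathbb{R}^N_+=\{x=(x',x_N)\in\mathbb{R}^N: x'\in\mathbb{R}^{N-1},\,x_N>0\}$; $\Sigma_\lambda=\{x\in\mathbb{R}^N: 0<x_N<\lambda\}$ for $\lambda>0$; $\Delta_p u=\operatorname{div}(|\nabla u|^{p-2}\nabla u)$. Weak solution: $u\in W^{1,p}_{\rm loc}(\mathbb{R}^N_+)$ is a weak solution of the problem if $\operatorname{ess\,inf}_K u>0$ for every $K\subset\subset\mathbb{R}^N_+$; for all $\varphi\in C^1_c(\mathbb{R}^N_+)$, $$\int_{\mathbb{R}^N_+}|\nabla u|^{p-2}\langle\nabla u,\nabla\varphi\rangle=\int_{\mathbb{R}^N_+}\frac{\varphi}{u};$$ and the zero Dirichlet boundary condition holds in the sense that $(u-\varepsilon)^+\varphi\,\chi_{\mathbb{R}^N_+}\in W^{1,p}_0(\mathbb{R}^N_+)$ for every $\varphi\in C^1_c(\mathbb{R}^N)$ and every $\varepsilon>0$. *)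

(* Defs.v *)
From HB Require Import structures.
From mathcomp Require Import all_boot all_order all_algebra.
From mathcomp Require Import all_classical all_reals all_analysis.
From mathcomp Require Import ess_sup_inf.

Set Implicit Arguments.
Unset Strict Implicit.
Unset Printing Implicit Defensive.

Import Order.TTheory GRing.Theory Num.Theory.
Import numFieldNormedType.Exports.

Local Open Scope classical_set_scope.
Local Open Scope ring_scope.

(* The product sigma-algebra on R^n, generated by the coordinates, following
   the library's instance for n.-tuple; since R is second countable it is also
   the Borel sigma-algebra of R^n. *)
Definition rV_display : measure_display.
Proof. exact: (measure_tuple_display default_measure_display). Qed.

Section rV_measurable.
Context {R : realType} {n : nat}.

Let coord (i : 'I_n) (v : 'rV[R]_n) : R := v ord0 i.

Let rV_set0 : g_sigma_preimage coord set0.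
Proof. exact: sigma_algebra0. Qed.

Let rV_setC A : g_sigma_preimage coord A -> g_sigma_preimage coord (~` A).
Proof. exact: sigma_algebraC. Qed.

Let rV_bigcup (F : (set 'rV[R]_n)^nat) :
  (forall i, g_sigma_preimage coord (F i)) ->
  g_sigma_preimage coord (\bigcup_i (F i)).
Proof. exact: sigma_algebra_bigcup. Qed.

HB.instance Definition _ := @isMeasurable.Build rV_display
  'rV[R]_n (g_sigma_preimage coord) rV_set0 rV_setC rV_bigcup.

Lemma measurable_rV_coord (i : 'I_n) :
  measurable_fun [set: 'rV[R]_n] (fun v => v ord0 i).
Proof.
move=> _ Y mY; rewrite setTI; apply: sub_sigma_algebra => /=.
rewrite -bigcup_seq/=; exists i => /=; first by rewrite mem_index_enum.
by exists Y => //; rewrite setTI.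
Qed.

Lemma measurable_fun_rVP d (T : measurableType d) (f : T -> 'rV[R]_n) :
  (forall i, measurable_fun [set: T] (fun t => f t ord0 i)) ->
  measurable_fun [set: T] f.
Proof.
move=> mf _ /= A mA; rewrite setTI.
suff : [set B | measurable (f @^-1` B)] A by [].
apply: mA; split.
  split; first by rewrite /= preimage_set0.
    by move=> B /= mB; rewrite setTD preimage_setC; exact: measurableC.
  by move=> F mF; rewrite /= preimage_bigcup; exact: bigcupT_measurable.
rewrite -bigcup_seq => B [i _ [C mC <-]] /=.
have := mf i measurableT C mC.
by rewrite !setTI.
Qed.
End rV_measurable.

Section rV_lebesgue.
Context {R : realType}.

Definition rV_cons n (xv : measurableTypeR R * 'rV[R]_n) : 'rV[R]_n.+1 :=
  row_mx (const_mx xv.1 : 'rV[R]_1) xv.2.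

Definition rV_uncons n (v : 'rV[R]_n.+1) : measurableTypeR R * 'rV[R]_n :=
  (v ord0 ord0, \row_i v ord0 (lift ord0 i)).

Lemma rV_consE n xv (i : 'I_n.+1) : rV_cons xv ord0 i =
  if unlift ord0 i is Some j then xv.2 ord0 j else xv.1.
Proof.
rewrite /rV_cons; case: unliftP => [j|] ->.
  have -> : lift ord0 j = rshift 1 j by exact: val_inj.
  by rewrite (row_mxEr (const_mx xv.1 : 'rV[R]_1)).
have -> : ord0 = lshift n (ord0 : 'I_1) :> 'I_(1 + n) by exact: val_inj.
by rewrite (row_mxEl (const_mx xv.1 : 'rV[R]_1)) mxE.
Qed.

Lemma rV_consK n : cancel (@rV_cons n) (@rV_uncons n).
Proof.
move=> [x v]; rewrite /rV_uncons rV_consE unlift_none; congr pair.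
by apply/rowP => i; rewrite mxE rV_consE liftK.
Qed.

Lemma rV_unconsK n : cancel (@rV_uncons n) (@rV_cons n).
Proof.
move=> v; apply/rowP => i; rewrite rV_consE.
by case: unliftP => [j|] -> //=; rewrite mxE.
Qed.

Lemma measurable_rV_cons n : measurable_fun setT (@rV_cons n).
Proof.
apply: measurable_fun_rVP => i; under eq_fun do rewrite rV_consE.
case: unliftP => [j _|_]; last exact: measurable_fst.
exact: (measurableT_comp (measurable_rV_coord j) measurable_snd).
Qed.

Lemma measurable_rV_uncons n : measurable_fun setT (@rV_uncons n).
Proof.
apply/measurable_fun_pairP; split; first exact: (measurable_rV_coord ord0).
apply: measurable_fun_rVP => i.
under eq_fun do rewrite /= mxE.
exact: measurable_rV_coord.
Qed.

Section rV_measure_cons.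
Context {n : nat} (mu : {sigma_finite_measure set 'rV[R]_n -> \bar R}).

Definition rV_measure_cons : set 'rV[R]_n.+1 -> \bar R :=
  pushforward (lebesgue_measure \x mu)%E (@rV_cons n).

Let lam : {measure set (measurableTypeR R * 'rV[R]_n)%type -> \bar R} :=
  (lebesgue_measure \x mu)%E.

Let rV_measure_cons0 : rV_measure_cons set0 = 0%E.
Proof. by rewrite /rV_measure_cons /pushforward preimage_set0 (measure0 lam). Qed.

Let rV_measure_cons_ge0 A : (0 <= rV_measure_cons A)%E.
Proof. exact: (measure_ge0 lam). Qed.

Let measurable_preimage A : measurable A -> measurable (@rV_cons n @^-1` A).
Proof.
by move=> mA; rewrite -[X in measurable X]setTI; exact: measurable_rV_cons.
Qed.

Let rV_measure_cons_sigma_additive : semi_sigma_additive rV_measure_cons.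
Proof.
move=> F mF tF mUF; rewrite /rV_measure_cons /pushforward preimage_bigcup.
apply: (@measure_semi_sigma_additive _ _ _ lam).
- by move=> k; exact: measurable_preimage.
- apply/trivIsetP => /= i j _ _ ij; rewrite -preimage_setI.
  by move/trivIsetP : tF => /(_ _ _ _ _ ij) ->//; rewrite preimage_set0.
- by rewrite -preimage_bigcup; exact: measurable_preimage.
Qed.

HB.instance Definition _ := isMeasure.Build _ _ _ rV_measure_cons
  rV_measure_cons0 rV_measure_cons_ge0 rV_measure_cons_sigma_additive.

Let rV_measure_cons_sigma_finite : sigma_finite setT rV_measure_cons.
Proof.
have /sigma_finiteP[F [TF ndF Foo]] := sigma_finiteT (@lebesgue_measure R).
have /sigma_finiteP[G [TG ndG Goo]] := sigma_finiteT mu.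
exists (fun k => @rV_uncons n @^-1` (F k `*` G k)).
  rewrite -preimage_bigcup -[LHS](preimage_setT (@rV_uncons n)).
  congr (_ @^-1` _); rewrite -setXTT TF TG predeqE => -[x y]; split.
    move=> [/= [k _ Fkx] [l _ Gly]]; exists (maxn k l) => //; split.
    - by move: x Fkx; exact/subsetPset/ndF/leq_maxl.
    - by move: y Gly; exact/subsetPset/ndG/leq_maxr.
  by move=> [k _ []/= ? ?]; split; exists k.
move=> k; have [mF Fkoo] := Foo k; have [mG Gkoo] := Goo k; split.
  rewrite -[X in measurable X]setTI; apply: measurable_rV_uncons => //.
  exact: measurableX.
rewrite /rV_measure_cons /pushforward -comp_preimage.
rewrite (_ : _ \o _ = id); last by apply/funext => x /=; rewrite rV_consK.
by rewrite preimage_id product_measure1E// lte_mul_pinfty// ge0_fin_numE.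
Qed.

HB.instance Definition _ := @Measure_isSigmaFinite.Build _ _ _
  rV_measure_cons rV_measure_cons_sigma_finite.

End rV_measure_cons.

(* The n-dimensional Lebesgue measure, built coordinate by coordinate as an
   iterated product measure; see lebesgue_rV_box. *)
Fixpoint lebesgue_rV n : {sigma_finite_measure set 'rV[R]_n -> \bar R} :=
  match n with
  | 0 => @dirac _ 'rV[R]_0 0 R
  | n.+1 => rV_measure_cons (lebesgue_rV n)
  end.

Lemma lebesgue_rV_box n (a b : 'rV[R]_n) :
  (forall i, a ord0 i <= b ord0 i) ->
  lebesgue_rV n [set v | forall i, a ord0 i <= v ord0 i <= b ord0 i] =
  (\prod_(i < n) (b ord0 i - a ord0 i))%:E.
Proof.
elim: n a b => [|n IH] a b ab.
  by rewrite big_ord0 /= diracE mem_set// => -[].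
rewrite big_ord_recl EFinM /= /rV_measure_cons /pushforward.
pose a' : 'rV[R]_n := \row_i a ord0 (lift ord0 i).
pose b' : 'rV[R]_n := \row_i b ord0 (lift ord0 i).
rewrite [X in _ X = _](_ : _ =
    (`[a ord0 ord0, b ord0 ord0] : set (measurableTypeR R)) `*`
    [set v : 'rV[R]_n | forall i, a' ord0 i <= v ord0 i <= b' ord0 i]); last first.
  apply/seteqP; split => -[x v] /=.
    move=> H; split; first by rewrite in_itv/=; have := H ord0; rewrite rV_consE unlift_none.
    by move=> i; have := H (lift ord0 i); rewrite rV_consE liftK !mxE.
  rewrite in_itv/= => -[H1 H2] i; rewrite rV_consE.
  by case: unliftP => [j ->|-> //]; have := H2 j; rewrite !mxE.
rewrite product_measure1E; last 2 first.
- exact: measurable_itv.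
- rewrite (_ : [set _ | _] = \bigcap_(i in [set: 'I_n])
      ((fun v : 'rV[R]_n => v ord0 i) @^-1` `[a' ord0 i, b' ord0 i])); last first.
    apply/seteqP; split => v /=; first by move=> H i _ /=; rewrite in_itv/=.
    by move=> H i; have := H i Logic.I; rewrite /= in_itv/=.
  apply: fin_bigcap_measurable => // i _.
  by rewrite -[X in measurable X]setTI; exact: measurable_rV_coord.
congr (_ * _)%E; last first.
  rewrite IH; last by move=> i; rewrite !mxE.
  by congr (_%:E); apply: eq_bigr => i _; rewrite !mxE.
have := @lebesgue_measure_itv R `[a ord0 ord0, b ord0 ord0].
rewrite /= lte_fin => ->.
have [_|ba] := ltP (a ord0 ord0) (b ord0 ord0); first by rewrite EFinB.
suff -> : a ord0 ord0 = b ord0 ord0 by rewrite subrr.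
by apply/eqP; rewrite eq_le ab.
Qed.

End rV_lebesgue.

Section sobolev.
Context {R : realType} {n : nat}.
Implicit Types (Om K : set 'rV[R]_n) (p : R) (u v f phi : 'rV[R]_n -> R).
Implicit Types g : 'rV[R]_n -> 'rV[R]_n.
Local Notation mu := (lebesgue_rV n).

Definition dotv (v w : 'rV[R]_n) : R := \sum_i v ord0 i * w ord0 i.

(* The Euclidean norm; the library's norm `|v| on row vectors is the sup norm. *)
Definition enorm (v : 'rV[R]_n) : R := Num.sqrt (dotv v v).

(* K is relatively compact in Om. *)
Definition compactly_contained K Om := compact (closure K) /\ closure K `<=` Om.

Definition grad phi (x : 'rV[R]_n) : 'rV[R]_n :=
  \row_i 'D_(delta_mx ord0 i) phi x.

Definition C1 phi := (forall x, differentiable phi x) /\ continuous (grad phi).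

(* Elements of C^1_c(Om) are represented by their extension by 0 to R^n. *)
Definition C1c Om phi := C1 phi /\ compactly_contained [set x | phi x != 0] Om.

(* The exponent q ranges over ]0, +oo]; the values of f off Om are irrelevant. *)
Definition Lp Om (q : \bar R) f :=
  measurable_fun Om f /\ finite_norm mu q (f \_ Om).

Definition Lp_loc Om (q : \bar R) f :=
  measurable_fun Om f /\
  forall K, compact K -> K `<=` Om -> finite_norm mu q (f \_ K).

(* Testing against C^1_c rather than C^oo_c is equivalent, by mollification. *)
Definition weak_gradient Om u g :=
  [/\ Lp_loc Om 1%E u,
      forall i, Lp_loc Om 1%E (fun x => g x ord0 i) &
      forall phi i, C1c Om phi ->
        (\int[mu]_(x in Om) (u x * grad phi x ord0 i)%:E =
         - \int[mu]_(x in Om) (g x ord0 i * phi x)%:E)%E].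

(* u belongs to W^{1,p}(Om), with gradient g. *)
Definition W1p Om p u g :=
  [/\ weak_gradient Om u g, Lp Om p%:E u &
      forall i, Lp Om p%:E (fun x => g x ord0 i)].

(* u belongs to W^{1,p}_loc(Om), with gradient g. *)
Definition W1p_loc Om p u g :=
  [/\ weak_gradient Om u g, Lp_loc Om p%:E u &
      forall i, Lp_loc Om p%:E (fun x => g x ord0 i)].

Definition W1p_norm Om p u g : \bar R :=
  ('N[mu]_(p%:E)[EFin \o (u \_ Om)] +
   \sum_(i < n) 'N[mu]_(p%:E)[EFin \o ((fun x => g x ord0 i) \_ Om)])%E.

(* W^{1,p}_0(Om), the closure of C^1_c(Om) in W^{1,p}(Om). *)
Definition W1p0 Om p v := exists2 g, W1p Om p v g &
  forall e : R, 0 < e -> exists2 phi, C1c Om phi &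
    (W1p_norm Om p (phi \- v)%R (grad phi \- g)%R < e%:E)%E.

Definition ess_inf_on K u : \bar R :=
  ess_inf mu (patch (cst +oo%E) K (EFin \o u)).

End sobolev.

Section problem.
Context {R : realType} {n : nat}.
Implicit Types (p : R) (u phi : 'rV[R]_n.+1 -> R).
Local Notation mu := (lebesgue_rV n.+1).

(* The last coordinate x_N of R^N, N = n.+1, has index ord_max. *)
Definition halfspace : set 'rV[R]_n.+1 := [set x | 0 < x ord0 ord_max].

Definition strip (lam : R) : set 'rV[R]_n.+1 :=
  [set x | 0 < x ord0 ord_max < lam].

(* Weak solutions u of - Delta_p u = 1 / u, u > 0 in the half-space, u = 0 on
   its boundary. The gradient Du of u is determined up to a null set. *)
Definition weak_solution p u := exists Du,
  [/\ W1p_loc halfspace p u Du,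
      forall K, compactly_contained K halfspace -> (0 < ess_inf_on K u)%E,
      forall phi, C1c halfspace phi ->
        (\int[mu]_(x in halfspace)
           (enorm (Du x) `^ (p - 2) * dotv (Du x) (grad phi x))%:E =
         \int[mu]_(x in halfspace) (phi x / u x)%:E)%E &
      forall phi (eps : R), C1c setT phi -> 0 < eps ->
        W1p0 halfspace p
          ((fun x => Num.max (u x - eps) 0 * phi x) \_ halfspace)].

End problem.

(* Main.v *)
Require Import Defs.
From mathcomp Require Import all_boot all_order all_algebra.
From mathcomp Require Import all_classical all_reals all_analysis.
From mathcomp Require Import measurable_realfun ess_sup_inf ring lra.
Set Implicit Arguments.
Unset Strict Implicit.
Unset Printing Implicit Defensive.
Import Order.TTheory GRing.Theory Num.Theory.
Import numFieldNormedType.Exports.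
Local Open Scope classical_set_scope.
Local Open Scope ring_scope.

(** Why there is no weak solution.

    The solution u is compared from below with explicit subsolutions w living
    on large balls inside the half-space, and at a fixed distance from the
    boundary these subsolutions can be made as large as one wishes.

    The model is the one-dimensional equation -(|w'|^(p-2) w')' = 1/w with
    w(0) = 0 and maximum M, whose solution grows near 0 like
    t (log (M/t))^(1/p), up to a constant: at distance one from the boundary
    it tends to infinity with M. The same happens in a ball of radius M. With
    y = (x - c) / M and s = 1 - |y|^(2m+2), the functions
      w = k M ((s + tau)^(1-th) - tau^(1-th)),   tau^(-th p) = 1 / th,
    replace the logarithm by a power with a small exponent th. Their flux is
      |Dw|^(p-2) Dw = - K^(p-1) (s + tau)^(-th(p-1)) |y|^(2e) y,
    and its divergence, computed in div_barrier_flux, yields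
    -div (|Dw|^(p-2) Dw) <= 1/w for a constant k that depends neither on th
    nor on M (barrier_subsolution). For M = 1 / (2 tau) and a ball at
    distance 1/2 from the boundary, w is at least a constant times th^(-1/p)
    on a fixed unit box (depth_test_box, exists_singular_parameters).

    The comparison u >= w (barrier_comparison, barrier_le_solution) would
    follow at once by testing both inequalities with the positive part of
    w - u: the p-Laplacian is monotone (pflux_monotone) and 1/u decreases
    in u. Test functions must be of class C1, so u is first replaced by C1
    functions v. These come from the boundary condition: on a box where
    u >= m > 0, the function (u - m)^+ phi is u - m as soon as phi = 1 there,
    and it is a limit in W^(1,p) of C1 functions; that the gradients converge
    to the weak gradient of u is the fundamental lemma of the calculus of
    variations (weak_gradient_unique, normalize_solution). With the test
    function eta S(w - v), where S is a smoothed Heaviside function, the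
    monotone term has the good sign before passing to the limit, and all the
    others are bounded by the distance from v to u in a weighted L1 norm,
    which Hoelder's inequality makes small.

    Hence u exceeds every constant almost everywhere on the unit box, which is
    absurd. *)

(** * Measurability and integrability of continuous functions on row vectors *)

Section measure_rV.
Context {R : realType} {n : nat}.
Local Notation V := 'rV[R]_n.
Local Notation mu := (@lebesgue_rV R n).

Definition cube (A : R) : set V := [set v | forall i, `|v ord0 i| <= A].

Lemma measurable_rV_forall (P : 'I_n -> set R) :
  (forall i, measurable (P i)) ->
  measurable [set v : V | forall i, P i (v ord0 i)].
Proof.
move=> mP; rewrite (_ : [set _ | _] =
   \bigcap_(i in [set: 'I_n]) ((fun v : V => v ord0 i) @^-1` P i)).
  apply: fin_bigcap_measurable => // i _.
  by rewrite -[X in measurable X]setTI; exact: measurable_rV_coord.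
by apply/seteqP; split => v /=; [move=> H i _; exact: H|move=> H i; exact: H].
Qed.

(** The sigma-algebra is generated by the coordinates, so an open set is written
    as a countable union of open cubes with rational centre and radius 1 / (j + 1). *)
Lemma open_measurable_rV (U : set V) : open U -> measurable U.
Proof.
move=> oU.
pose B (k : nat) : set V :=
  if @unpickle ('rV[rat]_n * nat)%type k is Some (q, j) then
    [set v | forall i, `|ratr (q ord0 i) - v ord0 i| < j.+1%:R^-1]
  else set0.
pose B' k := if `[< B k `<=` U >] then B k else set0.
have -> : U = \bigcup_k B' k.
  apply/seteqP; split => [x Ux|x [k _]]; last first.
    by rewrite /B'; case: asboolP => // BU /BU.
  have [e/= e0 eU] : exists2 e : R, 0 < e & ball x e `<=` U.
    by move: oU; rewrite openE => /(_ _ Ux) /nbhs_ballP[e e0 eU]; exists e.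
  pose j := Num.truncn (2 / e).
  have je : j.+1%:R^-1 < e / 2.
    have j2 : 2 / e < j.+1%:R by rewrite /j truncnS_gt.
    rewrite -[e / 2]invrK invf_div ltf_pV2 ?posrE ?divr_gt0//.
  have Hq i : {q : rat | `|ratr q - x ord0 i| < j.+1%:R^-1}.
    apply: cid; have [|q] := @rat_in_itvoo R (x ord0 i - j.+1%:R^-1) (x ord0 i + j.+1%:R^-1).
      by rewrite ltrD2l gt0_cp// invr_gt0.
    by rewrite in_itv/= => qx; exists q; rewrite ltr_distl.
  exists (pickle (\row_i sval (Hq i), j)) => //.
  rewrite /B' /B pickleK; case: asboolP => [_ i|].
    by rewrite mxE; exact: (svalP (Hq i)).
  case=> v /= vj; apply: eU.
  split=> // a i; rewrite (ord1 a) -ball_normE /=.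
  have := vj i; rewrite mxE => vi.
  have := svalP (Hq i); rewrite distrC => xi.
  rewrite (le_lt_trans (ler_distD (ratr (sval (Hq i))) _ _))//.
  by rewrite [e](splitr e) ltrD// (lt_trans _ je).
apply: bigcupT_measurable => k; rewrite /B'; case: asboolP => // _.
rewrite /B; case: unpickle => // -[q j].
apply: (@measurable_rV_forall (fun i => [set t | `|ratr (q ord0 i) - t| < j.+1%:R^-1])) => i.
by apply: open_measurable; apply: (@ball_open _ _ (ratr (q ord0 i) : R)); rewrite invr_gt0.
Qed.

Lemma continuous_measurable_rV (f : V -> R) : continuous f -> measurable_fun setT f.
Proof.
move=> cf; apply: (measurability _ (RGenOpens.measurableE R)).
move=> _ [_ [a [b ->] <-]]; rewrite setTI; apply: open_measurable_rV.
by move/continuousP : cf; apply; exact: interval_open.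
Qed.

Lemma measurable_cube A : measurable (cube A).
Proof.
apply: (@measurable_rV_forall (fun=> [set t | `|t| <= A])) => i.
rewrite (_ : [set _ | _] = `[-A, A]%classic).
  exact: measurable_itv.
by apply/seteqP; split => t /=; rewrite in_itv/= ler_norml.
Qed.

Lemma compact_cube A : compact (cube A).
Proof.
have := @rV_compact R n (fun=> `[-A, A]%classic) (fun=> @segment_compact _ _ _).
congr (compact _); apply/seteqP; split => v /= H i; have := H i;
  by rewrite /= in_itv /= ler_norml.
Qed.

Lemma cube_fin A : (mu (cube A) < +oo)%E.
Proof.
wlog A0 : A / 0 <= A => [H|].
  apply: le_lt_trans (H `|A| (normr_ge0 _)).
  apply: le_measure; rewrite ?inE; [exact: measurable_cube..|].
  by move=> x Ax i; rewrite (le_trans (Ax i))// ler_norm.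
rewrite (_ : cube A = [set v : V | forall i, (const_mx (- A) : V) ord0 i <= v ord0 i <=
     (const_mx A : V) ord0 i]).
  rewrite lebesgue_rV_box ?ltry// => i; rewrite !mxE.
  by rewrite (le_trans _ A0)// oppr_le0.
by apply/seteqP; split => v /= H i; have := H i; rewrite !mxE ler_norml.
Qed.

Lemma continuous_bounded_cube (f : V -> R) A : continuous f ->
  exists2 C : R, 0 <= C & forall x, cube A x -> `|f x| <= C.
Proof.
move=> cf; have : compact (f @` cube A).
  apply: continuous_compact; last exact: compact_cube.
  exact: continuous_subspaceT.
move=> /compact_bounded[M [_ HM]]; exists (`|M| + 1); first by rewrite addr_ge0.
move=> x xA; apply: (HM (`|M| + 1)); last by exists x.
by rewrite (le_lt_trans (ler_norm _))// ltrDl.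
Qed.

Lemma bounded_integrable (D : set V) (f : V -> R) (C : R) :
  measurable D -> (mu D < +oo)%E -> measurable_fun D f ->
  (forall x, D x -> `|f x| <= C) -> mu.-integrable D (EFin \o f).
Proof.
move=> mD Doo mf fC.
apply: (@le_integrable _ _ _ _ _ mD _ (EFin \o cst C)) => //.
- exact/measurable_EFinP.
- move=> x Dx; rewrite /= lee_fin (le_trans (fC _ Dx))// ler_norm//.
- apply/integrableP; split; first exact/measurable_EFinP.
  by rewrite /= integral_cst //= lte_mul_pinfty// lee_fin.
Qed.

Lemma continuous_integrable (f : V -> R) A : continuous f ->
  (forall x, ~ cube A x -> f x = 0) -> mu.-integrable setT (EFin \o f).
Proof.
move=> cf f0.
have [C C0 HC] := continuous_bounded_cube A cf.
have mf := continuous_measurable_rV cf.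
rewrite (_ : EFin \o f = (EFin \o f) \_ (cube A)); last first.
  apply/funext => x; rewrite patchE; case: ifPn => // /negP; rewrite inE => xA.
  by rewrite /= f0.
rewrite -integrable_mkcond; last exact: measurable_cube.
apply: (@bounded_integrable _ _ C) => //.
- exact: measurable_cube.
- exact: cube_fin.
- exact: measurable_funS mf.
Qed.

End measure_rV.

(** * Integrals of partial derivatives *)

Lemma continuous_rV (R : realType) (T : topologicalType) n (f : T -> 'rV[R]_n) :
  (forall i, continuous (fun x => f x ord0 i)) -> continuous f.
Proof.
move=> cf x; apply/cvg_ballP => e e0.
have H : \forall y \near x, forall i, ball (f x ord0 i) e (f y ord0 i).
  by apply: filter_forall => i; have /cvg_ballP/(_ _ e0) := cf i x.
near=> y; split=> // a i; rewrite (ord1 a).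
by move: i; near: y.
Unshelve. all: by end_near. Qed.

(** The two difference quotients are the same function of h. This moves a partial
    derivative to a slice of the space, and to an affine function on the line. *)
Lemma is_derive_slice (R : realType) (V1 V2 : normedModType R)
    (f1 : V1 -> R) (f2 : V2 -> R) x1 v1 x2 v2 (d : R) :
  (forall h : R, f1 (h *: v1 + x1) = f2 (h *: v2 + x2)) ->
  is_derive x1 v1 f1 d -> is_derive x2 v2 f2 d.
Proof.
move=> f12 [df1 <-].
have E : (fun h : R => h^-1 *: ((f1 \o shift x1) (h *: v1) - f1 x1)) =
         (fun h : R => h^-1 *: ((f2 \o shift x2) (h *: v2) - f2 x2)).
  apply/funext => h /=; rewrite f12; congr (_ *: (_ - _)).
  by have := f12 0; rewrite !scale0r !add0r.
by split; [move: df1; rewrite /derivable E|rewrite /derive -E].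
Qed.

Section ibp.
Context {R : realType}.

Lemma integral_derive1_eq0 (G g : R -> R) (A : R) :
  (forall t : R, is_derive t 1 G (g t)) -> continuous g ->
  (forall t, A < `|t| -> G t = 0) -> (forall t, A < `|t| -> g t = 0) ->
  (\int[lebesgue_measure]_t (g t)%:E = 0)%E.
Proof.
(* G vanishes at both ends of the larger interval [-B, B]. *)
move=> dG cg G0 g0; pose B : R := `|A| + 1.
have AB : A < B by rewrite (le_lt_trans (ler_norm _))// ltrDl.
have B0 : 0 < B by rewrite ltr_wpDl.
have cG : continuous G.
  move=> t; apply: differentiable_continuous; apply/derivable1_diffP.
  by have [] := dG t.
have -> : (\int[lebesgue_measure]_t (g t)%:E =
           \int[lebesgue_measure]_(t in `[(- B)%R, B]) (g t)%:E)%E.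
  rewrite [RHS]integral_mkcond; apply: eq_integral => t _.
  rewrite patchE; case: ifPn => // /negP; rewrite inE/= in_itv/= -ler_norml => /negP.
  by rewrite -ltNge => Bt; rewrite g0// (lt_trans AB).
rewrite (@continuous_FTC2 _ g G).
- by rewrite !G0 ?subee// ?normrN gtr0_norm.
- by rewrite gtrN.
- exact: continuous_subspaceT.
- split; first by move=> t _; have [] := dG t.
  + exact/cvg_at_right_filter/cG.
  + exact/cvg_at_left_filter/cG.
- by move=> t _; rewrite derive1E; have [] := dG t.
Qed.

Lemma rV_cons_continuousl n (v : 'rV[R]_n) : continuous (fun t : R => rV_cons (t, v)).
Proof.
apply: continuous_rV => i t; under eq_fun do rewrite rV_consE.
by case: unliftP => [j|] _ /=; [exact: cvg_cst|].
Qed.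

Lemma rV_cons_continuousr n (t : R) : continuous (fun v : 'rV[R]_n => rV_cons (t, v)).
Proof.
apply: continuous_rV => i v; under eq_fun do rewrite rV_consE.
by case: unliftP => [j|] _ /=; [exact: coord_continuous|exact: cst_continuous].
Qed.

Lemma cube_rV_cons n (t : R) (v : 'rV[R]_n) A :
  cube A (rV_cons (t, v)) <-> (`|t| <= A) /\ cube A v.
Proof.
split=> [H|[tA vA] i].
  split; first by have := H ord0; rewrite rV_consE unlift_none.
  by move=> j; have := H (lift ord0 j); rewrite rV_consE liftK.
by rewrite rV_consE; case: unliftP => [j|] _.
Qed.

(** By Fubini it suffices to integrate along direction i first, where the
    fundamental theorem of calculus applies. The measure is built by adding the
    first coordinate, so a later coordinate is reached by induction on n. *)
Lemma integral_partial_eq0 n (F dF : 'rV[R]_n -> R) (i : 'I_n) (A : R) :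
  (forall x, is_derive x (delta_mx ord0 i) F (dF x)) -> continuous dF ->
  (forall x, ~ cube A x -> F x = 0) -> (forall x, ~ cube A x -> dF x = 0) ->
  (\int[lebesgue_rV n]_x (dF x)%:E = 0)%E.
Proof.
elim: n F dF i => [|n IH] F dF i dF1 cdF F0 dF0; first by case: i {dF1}.
have idF := continuous_integrable cdF dF0.
pose m : {measure set (measurableTypeR R * 'rV[R]_n)%type -> \bar R} :=
  (lebesgue_measure \x lebesgue_rV n)%E.
have mdF : measurable_fun setT (EFin \o dF).
  apply/measurable_EFinP. exact: continuous_measurable_rV.
have mdFc : measurable_fun setT ((EFin \o dF) \o @rV_cons R n).
  by apply: measurableT_comp => //; exact: measurable_rV_cons.
have icdF : m.-integrable setT ((EFin \o dF) \o @rV_cons R n).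
  apply/integrableP; split => //.
  have /integrableP[_] := idF; congr (_ < _)%E.
  apply: (@ge0_integral_pushforward _ _ _ _ _ _ (@measurable_rV_cons R n) m setT
     (abse \o (EFin \o dF))) => //; [exact: measurableT_comp|by move=> y _; rewrite /= lee_fin].
transitivity (\int[pushforward m (@rV_cons R n)]_x (EFin \o dF) x)%E; first by [].
rewrite (integral_pushforward (@measurable_rV_cons R n))// preimage_setT.
case: (unliftP ord0 i) => [j|] ij.
- rewrite -integral12_prod_meas1//; apply: integral0_eq => t _.
  rewrite /fubini_F /=.
  apply: (IH (fun v => F (rV_cons (t, v))) _ j).
  + move=> v; apply: is_derive_slice (dF1 (rV_cons (t, v))) => h.
    congr F; apply/rowP => k; rewrite mxE !rV_consE mxE mxE eqxx/= ij.
    case: unliftP => [k'|] ->; rewrite ?mxE ?eqxx ?(inj_eq lift_inj)//=.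
    by rewrite ?(negbTE (neq_lift _ _)) ?[_ == ord0]eq_sym ?(negbTE (neq_lift _ _)) ?mulr0 ?add0r.
  + move=> v; apply: continuous_comp; [exact: rV_cons_continuousr|exact: cdF].
  + by move=> v vA; apply: F0 => /cube_rV_cons[].
  + by move=> v vA; apply: dF0 => /cube_rV_cons[].
- rewrite -integral21_prod_meas1//; apply: integral0_eq => v _.
  rewrite /fubini_G /=.
  apply: (@integral_derive1_eq0 (fun t => F (rV_cons (t, v))) _ A).
  + move=> t; apply: is_derive_slice (dF1 (rV_cons (t, v))) => h.
    congr F; apply/rowP => k; rewrite mxE !rV_consE mxE mxE eqxx/= ij.
    case: unliftP => [k'|] ->; rewrite ?mxE ?eqxx//=.
    by rewrite ?mulr0 ?add0r ?mulr1.
  + by move=> t; apply: continuous_comp; [exact: rV_cons_continuousl|exact: cdF].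
  + by move=> t At; apply: F0 => /cube_rV_cons[tA _]; move: tA; rewrite leNgt At.
  + by move=> t At; apply: dF0 => /cube_rV_cons[tA _]; move: tA; rewrite leNgt At.
Qed.

End ibp.

(** * Functions of class C1 on the line *)

Section onedim.
Context {R : realType}.

(** The derivative is an argument, so that the closure lemmas below compute it;
    hasgrad follows the same pattern for gradients. *)
Definition hasderiv (f df : R -> R) :=
  (forall t : R, is_derive t 1 f (df t)) /\ continuous df.

Lemma hasderiv_continuous f df : hasderiv f df -> continuous f.
Proof.
move=> [fdf _] t; apply: differentiable_continuous; apply/derivable1_diffP.
by have [] := fdf t.
Qed.

Definition pospart (t : R) : R := Num.max t 0.

Lemma pospart_ge0 t : 0 <= pospart t. Proof. by rewrite /pospart le_max lexx orbT. Qed.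

Lemma pospart_pos t : 0 <= t -> pospart t = t. Proof. by move=> t0; rewrite /pospart max_l. Qed.

Lemma pospart_neg t : t <= 0 -> pospart t = 0. Proof. by move=> t0; rewrite /pospart max_r. Qed.

(** A power of a negative number is 1 by convention, hence the truncation. *)
Definition pospow (q t : R) : R := pospart t `^ q.

Lemma pospow_ge0 q t : 0 <= pospow q t. Proof. exact: powR_ge0. Qed.

Lemma pospow_pos q t : 0 <= t -> pospow q t = t `^ q.
Proof. by move=> t0; rewrite /pospow pospart_pos. Qed.

Lemma pospow_neg q t : q != 0 -> t <= 0 -> pospow q t = 0.
Proof. by move=> q0 t0; rewrite /pospow pospart_neg// powR0. Qed.

Lemma pospow_continuous (q : R) : 0 < q -> continuous (pospow q).
Proof.
move=> q0 t; have qN0 : q != 0 by rewrite gt_eqF.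
have [t0|t0|->] := ltgtP t 0.
- have : \forall s \near t, cst 0 s = pospow q s.
    by near=> s; rewrite pospow_neg// ltW//; near: s; exact: lt_nbhsl.
  rewrite /continuous_at pospow_neg ?ltW// => H.
  by apply: (cvg_trans (near_eq_cvg H)); exact: (@cvg_cst _ (0:R)).
- have : \forall s \near t, (fun s : R => s `^ q) s = pospow q s.
    by near=> s; rewrite pospow_pos// ltW//; near: s; exact: lt_nbhsr.
  rewrite /continuous_at pospow_pos ?ltW// => H.
  apply: (cvg_trans (near_eq_cvg H)).
  have [dp _] := @is_derive1_powR R q t t0.
  have /differentiable_continuous : differentiable (fun s : R => s `^ q) t.
    exact/derivable1_diffP.
  by [].
- rewrite /continuous_at pospow_neg//; apply/cvgr0Pnorm_lt => e e0.
  have : \forall s \near (0:R), `|s| < e `^ q^-1.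
    by apply: nbhs0_lt; rewrite powR_gt0.
  apply: filterS => s sq; rewrite ger0_norm ?pospow_ge0//.
  have [s0|s0] := leP s 0; first by rewrite pospow_neg.
  rewrite pospow_pos ?ltW//.
  have -> : e = (e `^ q^-1) `^ q by rewrite -powRrM mulVf// powRr1// ltW.
  by rewrite gt0_ltr_powR ?nnegrE ?powR_ge0 ?(ltW s0)// (le_lt_trans _ sq)// ler_norm.
Unshelve. all: by end_near. Qed.

(** At 0 the difference quotient at h is exactly pospow (q - 1) h. *)
Lemma is_derive_pospow (q t : R) : 1 < q -> is_derive t 1 (pospow q) (q * pospow (q - 1) t).
Proof.
move=> q1; have q0 : 0 < q by rewrite (lt_trans _ q1).
have q10 : 0 < q - 1 by rewrite subr_gt0.
have [qN0 q1N0] : q != 0 /\ q - 1 != 0 by rewrite !gt_eqF.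
have [t0|t0|->] := ltgtP t 0.
- have H : \forall s \near t, cst 0 s = pospow q s.
    by near=> s; rewrite pospow_neg// ltW//; near: s; exact: lt_nbhsl.
  apply: (near_eq_is_derive H).
  by rewrite pospow_neg ?ltW// mulr0; exact: is_derive_cst.
- have H : \forall s \near t, (fun s : R => s `^ q) s = pospow q s.
    by near=> s; rewrite pospow_pos// ltW//; near: s; exact: lt_nbhsr.
  apply: (near_eq_is_derive H).
  by rewrite pospow_pos ?ltW//; exact: is_derive1_powR.
- rewrite pospow_neg// mulr0.
  have H : (fun h : R => h^-1 *: ((pospow q \o shift 0) (h *: (1 : R)) - pospow q 0)) @ 0^' --> (0 : R).
    have : \forall h \near 0^', pospow (q - 1) h =
      h^-1 *: ((pospow q \o shift 0) (h *: (1 : R)) - pospow q 0).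
      rewrite /dnbhs near_withinE; apply: nearW => h h0.
      rewrite /= addr0 [pospow q 0]pospow_neg// subr0 /GRing.scale/= mulr1.
      have [h1|h1] := leP h 0; first by rewrite !pospow_neg// mulr0.
      by rewrite !pospow_pos ?ltW// powRB ?h0 ?implybT// powRr1 ?(ltW h1)// mulrC.
    move=> H; apply: (cvg_trans (near_eq_cvg H)).
    have : pospow (q - 1) x @[x --> (0 : R)] --> (0 : R).
      by rewrite -[X in _ --> X](pospow_neg q1N0 (lexx 0)); exact: pospow_continuous.
    exact: cvg_within_filter.
  split; first by apply/cvg_ex; exists 0.
  exact: cvg_lim.
Unshelve. all: by end_near. Qed.

Lemma hasderiv_pospow (q : R) : 1 < q -> hasderiv (pospow q) (fun t => q * pospow (q - 1) t).
Proof.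
move=> q1; split=> t; first exact: is_derive_pospow.
by apply: cvgMr; apply: pospow_continuous; rewrite subr_gt0.
Qed.

(** The quadratic spline whose derivative is the tent of height 2 over [0, 1].
    It serves as a smoothed Heaviside function and as a cutoff. *)
Definition smoothstep (t : R) : R :=
  2 * pospow 2 t - 4 * pospow 2 (t - 2^-1) + 2 * pospow 2 (t - 1).

Definition dsmoothstep (t : R) : R :=
  4 * pospart t - 8 * pospart (t - 2^-1) + 4 * pospart (t - 1).

Lemma pospow2E (t : R) : pospow 2 t = pospart t ^+ 2.
Proof. by rewrite /pospow -powR_mulrn// pospart_ge0. Qed.

Lemma pospow1E (t : R) : pospow (2 - 1) t = pospart t.
Proof.
rewrite /pospow (_ : (2 - 1 = 1 :> R)); last by ring.
by rewrite powRr1// pospart_ge0.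
Qed.

Lemma smoothstep_le0 t : t <= 0 -> smoothstep t = 0.
Proof.
move=> t0; rewrite /smoothstep !pospow2E.
rewrite !pospart_neg; lra.
Qed.

Lemma smoothstep_ge1 t : 1 <= t -> smoothstep t = 1.
Proof.
move=> t1; rewrite /smoothstep !pospow2E.
by rewrite !pospart_pos; [field|lra..].
Qed.

Lemma smoothstep_itv t : 0 <= smoothstep t <= 1.
Proof.
rewrite /smoothstep !pospow2E.
have [t0|t0] := leP t 0; first by rewrite !pospart_neg; lra.
have m1 : pospart t = t by apply: pospart_pos; lra.
have [t2|t2] := leP t 2^-1.
  have m2 : pospart (t - 2^-1) = 0 by apply: pospart_neg; lra.
  have m3 : pospart (t - 1) = 0 by apply: pospart_neg; lra.
  rewrite m1 m2 m3; apply/andP; split; nra.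
have m2 : pospart (t - 2^-1) = t - 2^-1 by apply: pospart_pos; lra.
have [t3|t3] := leP t 1.
  have m3 : pospart (t - 1) = 0 by apply: pospart_neg; lra.
  rewrite m1 m2 m3; apply/andP; split; nra.
have m3 : pospart (t - 1) = t - 1 by apply: pospart_pos; lra.
rewrite m1 m2 m3; apply/andP; split; nra.
Qed.

Lemma smoothstep_gt0 t : 0 < t -> 0 < smoothstep t.
Proof.
move=> t0'; rewrite /smoothstep !pospow2E.
have [t0|t0] := leP t 0; first by rewrite !pospart_neg; lra.
have m1 : pospart t = t by apply: pospart_pos; lra.
have [t2|t2] := leP t 2^-1.
  have m2 : pospart (t - 2^-1) = 0 by apply: pospart_neg; lra.
  have m3 : pospart (t - 1) = 0 by apply: pospart_neg; lra.
  rewrite m1 m2 m3; nra.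
have m2 : pospart (t - 2^-1) = t - 2^-1 by apply: pospart_pos; lra.
have [t3|t3] := leP t 1.
  have m3 : pospart (t - 1) = 0 by apply: pospart_neg; lra.
  rewrite m1 m2 m3; nra.
have m3 : pospart (t - 1) = t - 1 by apply: pospart_pos; lra.
rewrite m1 m2 m3; nra.
Qed.

Lemma dsmoothstep_itv t : 0 <= dsmoothstep t <= 2.
Proof.
rewrite /dsmoothstep.
have [t0|t0] := leP t 0; first by rewrite !pospart_neg; lra.
have m1 : pospart t = t by apply: pospart_pos; lra.
have [t2|t2] := leP t 2^-1.
  have m2 : pospart (t - 2^-1) = 0 by apply: pospart_neg; lra.
  have m3 : pospart (t - 1) = 0 by apply: pospart_neg; lra.
  rewrite m1 m2 m3; lra.
have m2 : pospart (t - 2^-1) = t - 2^-1 by apply: pospart_pos; lra.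
have [t3|t3] := leP t 1.
  have m3 : pospart (t - 1) = 0 by apply: pospart_neg; lra.
  rewrite m1 m2 m3; lra.
have m3 : pospart (t - 1) = t - 1 by apply: pospart_pos; lra.
rewrite m1 m2 m3; lra.
Qed.

Lemma dsmoothstep_le0 t : t <= 0 -> dsmoothstep t = 0.
Proof. by move=> t0; rewrite /dsmoothstep !pospart_neg; lra. Qed.

Lemma dsmoothstep_ge1 (t : R) : 1 <= t -> dsmoothstep t = 0.
Proof. by move=> t1; rewrite /dsmoothstep !pospart_pos; lra. Qed.

Lemma hasderiv_eq (f df g dg : R -> R) : hasderiv f df -> f =1 g -> df =1 dg -> hasderiv g dg.
Proof. by move=> ? /funext <- /funext <-. Qed.

Lemma hasderiv_cst (c : R) : hasderiv (fun=> c) (fun=> 0).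
Proof. by split=> t; [exact: is_derive_cst|exact: cst_continuous]. Qed.

Lemma hasderiv_id : hasderiv id (fun=> 1).
Proof. by split=> t; [exact: is_derive_id|exact: cst_continuous]. Qed.

Lemma hasderivD f df g dg : hasderiv f df -> hasderiv g dg ->
  hasderiv (fun t => f t + g t) (fun t => df t + dg t).
Proof.
move=> [f1 f2] [g1 g2]; split=> t; first exact: is_deriveD.
by apply: cvgD; [exact: f2|exact: g2].
Qed.

Lemma hasderivM f df g dg : hasderiv f df -> hasderiv g dg ->
  hasderiv (fun t => f t * g t) (fun t => f t * dg t + g t * df t).
Proof.
move=> Cf Cg; have [cf cg] := (hasderiv_continuous Cf, hasderiv_continuous Cg).
case: Cf Cg => [f1 f2] [g1 g2]; split=> t; first exact: is_deriveM.
by apply: cvgD; apply: cvgM; [exact: cf|exact: g2|exact: cg|exact: f2].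
Qed.

Lemma hasderiv_comp f df g dg : hasderiv f df -> hasderiv g dg ->
  hasderiv (fun t => g (f t)) (fun t => dg (f t) * df t).
Proof.
move=> Cf Cg; have [cf cg] := (hasderiv_continuous Cf, hasderiv_continuous Cg).
case: Cf Cg => [f1 f2] [g1 g2]; split=> t.
  have [df1 <-] := f1 t; have [dg1 <-] := g1 (f t).
  split.
    apply/derivable1_diffP; apply: differentiable_comp; exact/derivable1_diffP.
  by rewrite -!derive1E -derive1_comp.
apply: cvgM; last exact: f2.
by apply: continuous_comp; [exact: cf|exact: g2].
Qed.

Lemma hasderiv_smoothstep : hasderiv smoothstep dsmoothstep.
Proof.
have P2 : hasderiv (pospow 2) (fun t => 2 * pospow (2 - 1) t) by apply: hasderiv_pospow; lra.
have H (a c : R) : hasderiv (fun t => a * pospow 2 (t - c)) (fun t => 2 * a * pospart (t - c)).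
  have := hasderivM (hasderiv_cst a) (hasderiv_comp (hasderivD hasderiv_id (hasderiv_cst (- c))) P2).
  move=> /hasderiv_eq; apply=> t //=.
  by rewrite pospow1E; ring.
have := hasderivD (hasderivD (H 2 0) (H (-4) 2^-1)) (H 2 1).
by move=> /hasderiv_eq; apply=> t; rewrite /smoothstep /dsmoothstep ?subr0; ring.
Qed.

Lemma hasderiv_lipschitz (f df : R -> R) (L : R) : hasderiv f df -> (forall t, `|df t| <= L) ->
  forall a b, `|f a - f b| <= L * `|a - b|.
Proof.
move=> Cf dfL a b; wlog ab : a b / b <= a => [H|].
  by have [/H|/ltW/H//] := leP b a; last by rewrite distrC [`|b - a|]distrC.
have [c _ ->] := MVT_segment ab (fun t _ => Cf.1 t)
  (continuous_subspaceT (hasderiv_continuous Cf)).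
by rewrite normrM ler_wpM2r.
Qed.

Lemma smoothstep_lipschitz (a b : R) : `|smoothstep a - smoothstep b| <= 2 * `|a - b|.
Proof.
apply: (hasderiv_lipschitz hasderiv_smoothstep) => t; have /andP[d0 d2] := dsmoothstep_itv t.
by rewrite ger0_norm.
Qed.

End onedim.

(** * Functions of class C1 on row vectors *)

Section calculus_rV.
Context {R : realType} {n : nat}.
Local Notation V := 'rV[R]_n.
Implicit Types (f : V -> R) (g df dg : V -> V).

Lemma continuous_funD (T : topologicalType) (W : normedModType R) (f g : T -> W) :
  continuous f -> continuous g -> continuous (fun x => f x + g x).
Proof. by move=> cf cg x; apply: (@continuousD R W T f g x); [exact: cf|exact: cg]. Qed.

Lemma continuous_funZ (T : topologicalType) (W : normedModType R) (f : T -> R) (g : T -> W) :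
  continuous f -> continuous g -> continuous (fun x => f x *: g x).
Proof. by move=> cf cg x; apply: (@continuousZ R W T f g x); [exact: cf|exact: cg]. Qed.

Lemma continuous_funM (T : topologicalType) (f g : T -> R) :
  continuous f -> continuous g -> continuous (fun x => f x * g x).
Proof. by move=> cf cg x; apply: (@continuousM R T f g x); [exact: cf|exact: cg]. Qed.

Lemma continuous_fun_comp (T U W : topologicalType) (f : T -> U) (g : U -> W) :
  continuous f -> continuous g -> continuous (fun x => g (f x)).
Proof. by move=> cf cg x; apply: continuous_comp; [exact: cf|exact: cg]. Qed.

Lemma continuous_fun_sum (T : topologicalType) (I : Type) (r : seq I) (f : I -> T -> R) :
  (forall i, continuous (f i)) -> continuous (fun x => \sum_(i <- r) f i x).
Proof.
move=> cf; elim: r => [|i r IH].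
  by under eq_fun do rewrite big_nil; exact: cst_continuous.
by under eq_fun do rewrite big_cons; exact: continuous_funD.
Qed.

Definition hasgrad (f : V -> R) (g : V -> V) :=
  [/\ forall x, differentiable f x, forall x, grad f x = g x & continuous g].

Lemma hasgrad_C1 f g : hasgrad f g -> C1 f.
Proof. by move=> [df /funext gf cg]; split => //; rewrite gf. Qed.

Lemma C1_hasgrad f : C1 f -> hasgrad f (grad f).
Proof. by case. Qed.

Lemma hasgrad_continuous f g : hasgrad f g -> continuous f.
Proof. by move=> [df _ _] x; exact: differentiable_continuous. Qed.

Lemma hasgrad_is_derive f g i x : hasgrad f g ->
  is_derive x (delta_mx ord0 i) f (g x ord0 i).
Proof.
move=> [df gf _]; split; first exact: diff_derivable.
by rewrite -gf mxE.
Qed.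

Lemma hasgrad_coordwise f g : (forall x, differentiable f x) ->
  (forall x i, 'D_(delta_mx ord0 i) f x = g x ord0 i) ->
  (forall i, continuous (fun x => g x ord0 i)) -> hasgrad f g.
Proof.
move=> df gf cg; split => //; last exact: continuous_rV.
by move=> x; apply/rowP => i; rewrite mxE gf.
Qed.

Lemma hasgrad_coordc f g i : hasgrad f g -> continuous (fun x => g x ord0 i).
Proof.
move=> [_ _ cg] x; apply: (@continuous_comp _ _ _ g (fun v : V => v ord0 i)); first exact: cg.
exact: coord_continuous.
Qed.

Lemma hasgrad_ext f (f' : V -> R) g (g' : V -> V) : hasgrad f g -> f =1 f' -> g =1 g' -> hasgrad f' g'.
Proof. by move=> ? /funext <- /funext <-. Qed.

Lemma hasgrad_cst (c : R) : hasgrad (fun=> c) (fun=> 0).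
Proof.
split=> [x|x|]; [exact: differentiable_cst| |exact: cst_continuous].
by apply/rowP => i; rewrite !mxE; exact: derive_cst.
Qed.

Lemma hasgrad_coord i : hasgrad (fun x => x ord0 i) (fun=> delta_mx ord0 i).
Proof.
apply: hasgrad_coordwise => [x|x j|j]; [exact: differentiable_coord| |exact: cst_continuous].
have [+ _] := hasderivD (hasderivM (hasderiv_cst (i == j)%:R) hasderiv_id) (hasderiv_cst (x ord0 i)).
move=> /(_ 0) d1.
have [_ ->] : is_derive x (delta_mx ord0 j) (fun v : V => v ord0 i) (i == j)%:R.
  apply: is_derive_eq.
    by apply: is_derive_slice d1 => h /=; rewrite !mxE eqxx/= [h *: _]mulr1 addr0 mulrC.
  by rewrite /= mulr0 mulr1 !addr0.
by rewrite mxE eqxx eq_sym.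
Qed.

Lemma hasgradD f (g : V -> R) df dg : hasgrad f df -> hasgrad g dg ->
  hasgrad (fun x => f x + g x) (fun x => df x + dg x).
Proof.
move=> Hf Hg; have [f1 f2 f3] := Hf; have [g1 g2 g3] := Hg.
split=> [x|x|]; first exact: differentiableD; last exact: continuous_funD.
apply/rowP => i; rewrite [LHS]mxE [RHS]mxE.
have [d1 <-] := hasgrad_is_derive i x Hf; have [d2 <-] := hasgrad_is_derive i x Hg.
exact: deriveD.
Qed.

Lemma hasgradM f (g : V -> R) df dg : hasgrad f df -> hasgrad g dg ->
  hasgrad (fun x => f x * g x) (fun x => f x *: dg x + g x *: df x).
Proof.
move=> Hf Hg; have [f1 f2 f3] := Hf; have [g1 g2 g3] := Hg.
have cf := hasgrad_continuous Hf; have cg := hasgrad_continuous Hg.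
split=> [x|x|]; [exact: differentiableM| |by apply: continuous_funD; exact: continuous_funZ].
apply/rowP => i; rewrite !mxE.
have [d1 <-] := hasgrad_is_derive i x Hf; have [d2 <-] := hasgrad_is_derive i x Hg.
exact: deriveM.
Qed.

Lemma hasgradZ (c : R) f df : hasgrad f df ->
  hasgrad (fun x => c * f x) (fun x => c *: df x).
Proof.
move=> Hf; apply: hasgrad_ext (hasgradM (hasgrad_cst c) Hf) _ _ => x //=.
by rewrite scaler0 addr0.
Qed.

Lemma hasgrad_comp f df (h dh : R -> R) : hasgrad f df -> hasderiv h dh ->
  hasgrad (fun x => h (f x)) (fun x => dh (f x) *: df x).
Proof.
move=> Hf Ch; have [f1 f2 f3] := Hf; have cf := hasgrad_continuous Hf.
have dh1 t : differentiable h t.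
  by apply/derivable1_diffP; have [] := Ch.1 t.
split=> [x|x|]; [exact: differentiable_comp| |].
  2: by apply: continuous_funZ => //; apply: continuous_fun_comp => //; exact: Ch.2.
apply/rowP => i; rewrite [LHS]mxE [RHS]mxE.
have [d1 <-] := hasgrad_is_derive i x Hf.
rewrite deriveE; last exact: differentiable_comp.
rewrite (@diff_comp _ _ _ _ f h)//= deriveE// deriv1E; last exact/derivable1_diffP.
by have [_ <-] := Ch.1 (f x); rewrite derive1E mulrC.
Qed.

Lemma hasgrad_sum (I : Type) (r : seq I) (f : I -> V -> R) (df : I -> V -> V) :
  (forall i, hasgrad (f i) (df i)) ->
  hasgrad (fun x => \sum_(i <- r) f i x) (fun x => \sum_(i <- r) df i x).
Proof.
move=> H; elim: r => [|i r IH].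
  by apply: hasgrad_ext (hasgrad_cst 0) _ _ => x; rewrite big_nil.
by apply: hasgrad_ext (hasgradD (H i) IH) _ _ => x; rewrite big_cons.
Qed.

End calculus_rV.

(** * Boxes and bump functions *)

Section boxes.
Context {R : realType} {n : nat}.
Local Notation V := 'rV[R]_n.
Local Notation mu := (@lebesgue_rV R n).
Implicit Types (a b c d : 'I_n -> R) (f : V -> R).

Definition cbox a b : set V := [set v | forall i, a i <= v ord0 i <= b i].
Definition obox a b : set V := [set v | forall i, a i < v ord0 i < b i].

Lemma obox_cbox a b : obox a b `<=` cbox a b.
Proof. by move=> v H i; have /andP[? ?] := H i; rewrite !ltW. Qed.

Lemma compact_cbox a b : compact (cbox a b).
Proof.
have := @rV_compact R n (fun i => `[a i, b i]%classic) (fun=> @segment_compact _ _ _).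
by congr (compact _); apply/seteqP; split => v /= H i; have := H i; rewrite /= in_itv.
Qed.

Lemma closed_cbox a b : closed (cbox a b).
Proof. by apply: compact_closed; [exact: norm_hausdorff|exact: compact_cbox]. Qed.

Lemma measurable_obox a b : measurable (obox a b).
Proof.
apply: (@measurable_rV_forall R n (fun i => [set t | a i < t < b i])) => i.
rewrite (_ : [set _ | _] = `]a i, b i[%classic); first exact: measurable_itv.
by apply/seteqP; split => t /=; rewrite in_itv.
Qed.

Lemma measurable_cbox a b : measurable (cbox a b : set V).
Proof.
apply: (@measurable_rV_forall R n (fun i => [set t | a i <= t <= b i])) => i.
rewrite (_ : [set _ | _] = `[a i, b i]%classic); first exact: measurable_itv.
by apply/seteqP; split => t /=; rewrite in_itv.
Qed.

Lemma cbox_cube a b : exists A, cbox a b `<=` cube A.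
Proof.
exists (\sum_i (`|a i| + `|b i|)) => v vab i.
rewrite (bigD1 i)//= ler_wpDr//; first by apply: sumr_ge0 => j _; rewrite addr_ge0.
have /andP[av vb] := vab i.
move: (normr_ge0 (a i)) (ler_norm (b i)) (normr_ge0 (b i)) (ler_norm (- a i)).
by rewrite normrN => *; rewrite ler_norml; apply/andP; split; lra.
Qed.

Lemma obox_fin a b : (mu (obox a b) < +oo)%E.
Proof.
have [A HA] := cbox_cube a b; apply: le_lt_trans (cube_fin A).
apply: le_measure; rewrite ?inE; [exact: measurable_obox|exact: measurable_cube|].
exact: subset_trans (@obox_cbox a b) HA.
Qed.

Lemma cbox_fin a b : (mu (cbox a b) < +oo)%E.
Proof.
have [A HA] := cbox_cube a b; apply: le_lt_trans (cube_fin A).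
by apply: le_measure; rewrite ?inE; [exact: measurable_cbox|exact: measurable_cube|].
Qed.

Lemma near0_grad f x : (\forall y \near x, f y = 0) -> grad f x = 0.
Proof.
move=> H; apply/rowP => i; rewrite !mxE.
rewrite (@near_eq_derive R V R f (cst 0)); first exact: derive_cst.
by apply: filterS H => y ->.
Qed.

Lemma grad_off_obox a b f x : (forall y, ~ obox a b y -> f y = 0) ->
  ~ cbox a b x -> grad f x = 0.
Proof.
move=> f0 xab; apply: near0_grad.
have : open (~` cbox a b) by rewrite openC; exact: closed_cbox.
rewrite openE => /(_ _ xab); apply: filterS => y yab.
by apply: f0 => /obox_cbox.
Qed.

Lemma C1c_obox Om a b f : C1 f -> (forall y, ~ obox a b y -> f y = 0) ->
  cbox a b `<=` Om -> C1c Om f.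
Proof.
move=> Cf f0 ab; split=> //.
have sub : closure [set x | f x != 0] `<=` cbox a b.
  rewrite [X in _ `<=` X](closure_id _).1; last exact: closed_cbox.
  apply: closure_subset => x /= fx; apply: contrapT => xab.
  by move/eqP: fx; apply; apply: f0 => /obox_cbox.
split; last exact: subset_trans sub ab.
apply: (subclosed_compact _ (@compact_cbox a b) sub); exact: closed_closure.
Qed.

Lemma C1_prod (I : Type) (r : seq I) (f : I -> V -> R) :
  (forall i, C1 (f i)) -> C1 (fun x => \prod_(i <- r) f i x).
Proof.
move=> Cf; elim: r => [|i r IH].
  apply: hasgrad_C1; apply: hasgrad_ext (hasgrad_cst 1) _ _ => // x.
  by rewrite big_nil.
apply: hasgrad_C1; apply: hasgrad_ext (hasgradM (C1_hasgrad (Cf i)) (C1_hasgrad IH)) _ _ => // x.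
by rewrite big_cons.
Qed.
Definition bump (k : R) a b (x : V) : R :=
  \prod_i (smoothstep (k * (x ord0 i - a i)) * smoothstep (k * (b i - x ord0 i))).

Lemma bump_itv k a b x : 0 <= bump k a b x <= 1.
Proof.
apply/andP; split.
  apply: prodr_ge0 => i _; have /andP[? _] := smoothstep_itv (k * (x ord0 i - a i)).
  have /andP[? _] := smoothstep_itv (k * (b i - x ord0 i)); exact: mulr_ge0.
apply: numdomain.Num.Theory.prodr_ile1 => i _; have /andP[? ?] := smoothstep_itv (k * (x ord0 i - a i)).
have /andP[? ?] := smoothstep_itv (k * (b i - x ord0 i)).
by rewrite mulr_ge0//= mulr_ile1.
Qed.

Lemma bump_C1 k a b : C1 (bump k a b).
Proof.
apply: C1_prod => i.
have H (c e : R) : hasgrad (fun x : V => smoothstep (k * (c * x ord0 i + e))) _ :=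
  hasgrad_comp (hasgradZ k (hasgradD (hasgradZ c (hasgrad_coord i)) (hasgrad_cst e))) hasderiv_smoothstep.
apply: hasgrad_C1; apply: hasgrad_ext (hasgradM (H 1 (- a i)) (H (-1) (b i))) _ _ => // x /=.
by congr (smoothstep _ * smoothstep _); ring.
Qed.

Lemma bump_off k a b x : 0 <= k -> ~ obox a b x -> bump k a b x = 0.
Proof.
move=> k0 /existsNP[i] /negP; rewrite negb_and -!leNgt => H.
rewrite /bump (bigD1 i)//=.
suff -> : smoothstep (k * (x ord0 i - a i)) * smoothstep (k * (b i - x ord0 i)) = 0 by rewrite mul0r.
apply/eqP; rewrite mulf_eq0; case/orP: H => H; apply/orP; [left|right];
  by rewrite smoothstep_le0// mulr_ge0_le0// subr_le0.
Qed.

(** For each x the sequence is eventually constant, since every factor is. *)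
Lemma bump_near a b x : \forall k \near \oo, bump k%:R a b x = \1_(obox a b) x.
Proof.
rewrite indicE; case: (boolP (_ \in _)); last first.
  by rewrite notin_setE => xab; near=> k; rewrite bump_off.
rewrite inE => xab.
have H i : \forall k \near \oo, 1 <= k%:R * (x ord0 i - a i) /\ 1 <= k%:R * (b i - x ord0 i).
  have /andP[h1 h2] := xab i.
  have [h1' h2'] : 0 < x ord0 i - a i /\ 0 < b i - x ord0 i by rewrite !subr_gt0.
  near=> k; split; rewrite -ler_pdivrMr// mul1r; near: k; exact: nbhs_infty_ger.
have : \forall k \near \oo, forall i, 1 <= k%:R * (x ord0 i - a i) /\ 1 <= k%:R * (b i - x ord0 i).
  exact: filter_forall.
apply: filterS => k Hk; rewrite /bump big1// => i _.
by have [h1 h2] := Hk i; rewrite !smoothstep_ge1// mulr1.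
Unshelve. all: by end_near. Qed.

End boxes.

(** * The fundamental lemma of the calculus of variations *)

Section fundamental.
Context {R : realType} {n : nat}.
Local Notation V := 'rV[R]_n.
Local Notation mu := (@lebesgue_rV R n).
Implicit Types (a b c d : 'I_n -> R).

Lemma oboxI a b c d : obox a b `&` obox c d =
  (obox (fun i => Num.max (a i) (c i)) (fun i => Num.min (b i) (d i)) : set V).
Proof.
apply/seteqP; split => v /=.
  move=> [H1 H2] i; have /andP[? ?] := H1 i; have /andP[? ?] := H2 i.
  by rewrite gt_max lt_min; do !(apply/andP; split).
by move=> H; split=> i; have := H i; rewrite gt_max lt_min;
  move=> /andP[/andP[? ?] /andP[? ?]]; apply/andP.
Qed.

(** Open boxes generate the sigma-algebra and are stable under intersection,
    which is what the pi-lambda theorem requires. *)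
Lemma measurable_rV_boxes :
  @measurable _ V = <<s [set A : set V | exists a b, A = obox a b] >>.
Proof.
set G := [set A : set V | _].
apply/seteqP; split => A; last first.
  move: A; apply: smallest_sub; first exact: sigma_algebra_measurable.
  by move=> _ [a [b ->]]; exact: measurable_obox.
move=> mA.
suff : measurable_fun setT (id : g_sigma_algebraType G -> V).
  by move=> /(_ measurableT _ mA); rewrite setTI preimage_id.
apply: measurable_fun_rVP => i.
apply: (measurability _ (RGenOpens.measurableE R)) => _ [_ [x [y ->]] <-].
rewrite setTI.
pose B k : set V := obox (fun j => if j == i then x else - k%:R)
                 (fun j => if j == i then y else k%:R).
rewrite (_ : _ @^-1` _ = \bigcup_k B k); last first.
  apply/seteqP; split => [v|v [k _ Bv]] /=; rewrite in_itv/=; last first.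
    by have := Bv i; rewrite eqxx.
  move=> vxy; have [A0 HA] := cbox_cube (fun j => v ord0 j) (fun j => v ord0 j).
  have {}HA : cube A0 v by apply: HA => j; rewrite !lexx.
  exists (Num.truncn A0).+1 => // j; case: eqP => [->//|_].
  by rewrite -ltr_norml (le_lt_trans (HA j))// truncnS_gt.
by apply: bigcupT_measurable => k; apply: sub_sigma_algebra; eexists; eexists.
Qed.

(** Bumps converge to indicators of open boxes, so by dominated convergence h has
    zero integral over every box, and then over every measurable set by the
    pi-lambda theorem. *)
Lemma fundamental_lemma_variations a b (h : V -> R) :
  mu.-integrable (obox a b) (EFin \o h) ->
  (forall psi, C1 psi -> (forall x, ~ obox a b x -> psi x = 0) ->
     (\int[mu]_(x in obox a b) (h x * psi x)%:E = 0)%E) ->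
  ae_eq mu (obox a b) (EFin \o h) (cst 0%E).
Proof.
set E := obox a b => ih Hh.
have mE : measurable E := @measurable_obox R n a b.
have mh : measurable_fun E h by apply/measurable_EFinP; exact: measurable_int ih.
(* The bumps of E `&` obox c d are supported in E, hence admissible. *)
have box0 c d : (\int[mu]_(x in E `&` obox c d) (h x)%:E = 0)%E.
  rewrite /E oboxI; set a' := (X in obox X _); set b' := (X in obox _ X).
  have sub : obox a' b' `<=` (E : set V) by rewrite -oboxI; exact: subIsetl.
  pose f k x := (h x * bump k%:R a' b' x)%:E.
  pose g x := (h x * \1_(obox a' b') x)%:E.
  have mb k : measurable_fun E (bump k%:R a' b').
    apply: (@measurable_funS _ _ _ _ setT) => //.
    apply: continuous_measurable_rV.
    exact: hasgrad_continuous (C1_hasgrad (bump_C1 _ _ _)).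
  have [|||||_ _] := @dominated_convergence _ _ _ mu E mE f g (abse \o (EFin \o h)).
  - by move=> k; apply/measurable_EFinP; exact: measurable_funM.
  - apply/measurable_EFinP; apply: measurable_funM => //.
    by apply: measurable_indic; exact: measurable_obox.
  - apply: aeW => x _; apply: cvg_near_cst.
    by apply: filterS (bump_near a' b' x) => k; rewrite /f /g => ->.
  - exact: integrable_abse.
  - apply: aeW => x k _; rewrite /f /= lee_fin normrM ler_piMr//.
    by have /andP[b0 b1] := bump_itv k%:R a' b' x; rewrite ger0_norm.
  rewrite (_ : (fun k => _) = cst 0%E); last first.
    apply/funext => k /=; apply: Hh; first exact: bump_C1.
    by move=> x xE; rewrite bump_off// => /sub.
  move=> cg; have g0 := cvg_unique (@ereal_hausdorff R) cg (@cvg_cst _ _ _ _ _).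
  rewrite -[RHS]g0 -[X in integral _ X](setIidr sub) integral_mkcondr.
  apply: eq_integral => x _; rewrite patchE /g indicE.
  by case: ifPn => _ /=; rewrite ?mulr1 ?mulr0.
have ihS S : measurable S -> mu.-integrable (E `&` S) (EFin \o h).
  by move=> mS; apply: integrableS ih => //; exact: measurableI.
have H S : measurable S -> (\int[mu]_(x in E `&` S) (h x)%:E = 0)%E.
  move=> mS; have := mS; rewrite measurable_rV_boxes => sS.
  apply: (@dynkin_induction _ V _ (fun S => (\int[mu]_(x in E `&` S) (h x)%:E = 0)%E)
     measurable_rV_boxes) sS.
  - move=> _ _ [a1 [b1 ->]] [a2 [b2 ->]]; rewrite oboxI; do 2 eexists; reflexivity.
  - by rewrite setIT -[E]setIid; exact: box0.
  - by move=> _ [c [d ->]]; exact: box0.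
  - move=> S1 mS1 h1.
    have : (\int[mu]_(x in E) (h x)%:E = 0)%E by rewrite -[E]setIid; exact: box0.
    rewrite -[X in integral _ X](setUIDK E S1) setDE integral_setU//.
    + by rewrite h1 add0e.
    + exact: measurableI.
    + by apply: measurableI => //; exact: measurableC.
    + by rewrite -setDE setUIDK; exact/measurable_EFinP.
    + by apply/disj_setPS => x [[_ ?] [_]].
  - move=> F mF tF hF; rewrite setI_bigcupr integral_bigcup//.
    + by rewrite eseries0.
    + exact: trivIset_setIl.
    + by move=> k; exact: measurableI.
    + by rewrite -setI_bigcupr; apply: ihS; exact: bigcupT_measurable.
apply: integral_ae_eq => //.
move=> S SE mS; rewrite integral0 -(H S mS); congr (integral _ _ _).
by rewrite setIidr.
Qed.
End fundamental.

(** * Monotonicity of the p-Laplacian flux *)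

Section vectors.
Context {R : realType} {n : nat}.
Local Notation V := 'rV[R]_n.
Implicit Types (u v w : V) (k p : R).

Lemma dotvC v w : dotv v w = dotv w v.
Proof. by apply: eq_bigr => i _; rewrite mulrC. Qed.

Lemma dotvDl u v w : dotv (u + v) w = dotv u w + dotv v w.
Proof. by rewrite -big_split/=; apply: eq_bigr => i _; rewrite mxE mulrDl. Qed.

Lemma dotvZl k v w : dotv (k *: v) w = k * dotv v w.
Proof. by rewrite mulr_sumr; apply: eq_bigr => i _; rewrite mxE mulrA. Qed.

Lemma dotvDr u v w : dotv u (v + w) = dotv u v + dotv u w.
Proof. by rewrite dotvC dotvDl !(dotvC u). Qed.

Lemma dotvZr k v w : dotv v (k *: w) = k * dotv v w.
Proof. by rewrite dotvC dotvZl dotvC. Qed.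

Lemma dotvNl v w : dotv (- v) w = - dotv v w.
Proof. by rewrite -scaleN1r dotvZl mulN1r. Qed.

Lemma dotvNr v w : dotv v (- w) = - dotv v w.
Proof. by rewrite dotvC dotvNl dotvC. Qed.

Lemma dot0v w : dotv 0 w = 0.
Proof. by rewrite -(scale0r 0) dotvZl mul0r. Qed.

Lemma dotv0 w : dotv w 0 = 0.
Proof. by rewrite dotvC dot0v. Qed.

Lemma dotvv_ge0 v : 0 <= dotv v v.
Proof. by apply: sumr_ge0 => i _; rewrite -expr2 sqr_ge0. Qed.

Lemma enorm_ge0 v : 0 <= enorm v. Proof. exact: sqrtr_ge0. Qed.

Lemma enorm_sqr v : enorm v ^+ 2 = dotv v v.
Proof. by rewrite sqr_sqrtr ?dotvv_ge0. Qed.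

Lemma le_coord_enorm v i : `|v ord0 i| <= enorm v.
Proof.
rewrite -sqrtr_sqr ler_sqrt ?dotvv_ge0// /dotv (bigD1 i)//= expr2 lerDl.
by apply: sumr_ge0 => j _; rewrite -expr2 sqr_ge0.
Qed.

Lemma enorm_eq0 v : enorm v = 0 -> v = 0.
Proof.
move=> v0; apply/rowP => i; rewrite mxE; apply/eqP; rewrite -normr_le0.
by rewrite -v0 le_coord_enorm.
Qed.

Lemma enormZ k v : enorm (k *: v) = `|k| * enorm v.
Proof.
rewrite /enorm dotvZl dotvZr mulrA -expr2 sqrtrM ?sqr_ge0//.
by rewrite sqrtr_sqr.
Qed.

Lemma enorm0 : enorm (0 : V) = 0.
Proof. by rewrite -(scale0r 0) enormZ normr0 mul0r. Qed.

(** Cauchy-Schwarz, from the nonnegativity of the square of |w| v - |v| w. *)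
Lemma dotv_le v w : dotv v w <= enorm v * enorm w.
Proof.
have [/enorm_eq0 ->|v0] := eqVneq (enorm v) 0; first by rewrite dot0v enorm0 mul0r.
have [/enorm_eq0 ->|w0] := eqVneq (enorm w) 0; first by rewrite dotv0 enorm0 mulr0.
have vw : 0 < enorm v * enorm w by rewrite mulr_gt0// lt0r ?v0 ?w0 enorm_ge0.
have := dotvv_ge0 (enorm w *: v - enorm v *: w).
rewrite !(dotvDl, dotvDr, dotvNl, dotvNr, dotvZl, dotvZr) -!enorm_sqr (dotvC w v).
nra.
Qed.

Lemma dotv_norm_le v w : `|dotv v w| <= enorm v * enorm w.
Proof.
rewrite ler_norml dotv_le andbT lerNl -dotvNl (le_trans (dotv_le _ _))//.
by rewrite -scaleN1r enormZ normrN1 mul1r.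
Qed.

Lemma enorm_le_sum v : enorm v <= \sum_i `|v ord0 i|.
Proof.
rewrite -[leRHS]ger0_norm ?sumr_ge0// -sqrtr_sqr ler_sqrt ?sqr_ge0//.
rewrite expr2 mulr_suml; apply: ler_sum => i _.
rewrite (le_trans (ler_norm _))// normrM ler_wpM2l//.
by rewrite (bigD1 i)//= lerDl sumr_ge0.
Qed.

(** The flux of the p-Laplacian: its divergence at v = Du is the p-Laplacian of u. *)
Definition pflux p v : V := enorm v `^ (p - 2) *: v.

Lemma pfluxE p v w : dotv (pflux p v) w = enorm v `^ (p - 2) * dotv v w.
Proof. exact: dotvZl. Qed.

Lemma enorm_pflux p v : 1 < p -> enorm (pflux p v) = enorm v `^ (p - 1).
Proof.
move=> p1; rewrite enormZ ger0_norm ?powR_ge0//.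
have [->|v0] := eqVneq (enorm v) 0.
  by rewrite mulr0 powR0// gt_eqF// subr_gt0.
rewrite -{2}(powRr1 (enorm_ge0 v)) -powRD ?v0 ?implybT//.
by congr (_ `^ _); ring.
Qed.

(** By Cauchy-Schwarz the product is at least
    (|v|^(p-1) - |w|^(p-1)) (|v| - |w|), whose factors have the same sign. *)
Lemma pflux_monotone p v w : 1 < p -> 0 <= dotv (pflux p v - pflux p w) (v - w).
Proof.
move=> p1.
have p10 : 0 <= p - 1 by rewrite subr_ge0 ltW.
rewrite !(dotvDl, dotvDr, dotvNl, dotvNr).
have self x : dotv (pflux p x) x = enorm x `^ (p - 1) * enorm x.
  rewrite pfluxE -enorm_sqr expr2 mulrA -enorm_pflux// enormZ.
  by rewrite ger0_norm ?powR_ge0.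
have := dotv_le (pflux p v) w; have := dotv_le (pflux p w) v.
rewrite !enorm_pflux// !self.
suff : 0 <= (enorm v `^ (p - 1) - enorm w `^ (p - 1)) * (enorm v - enorm w) by nra.
have [vw|wv] := leP (enorm v) (enorm w).
  apply: mulr_le0; rewrite subr_le0//.
  by apply: ge0_ler_powR; rewrite ?nnegrE ?enorm_ge0.
apply: mulr_ge0; rewrite subr_ge0 ?(ltW wv)//.
by apply: ge0_ler_powR; rewrite ?nnegrE ?enorm_ge0 ?(ltW wv).
Qed.

End vectors.

(** * Uniqueness of the weak gradient on a box *)

Section localization.
Context {R : realType} {n : nat}.
Local Notation V := 'rV[R]_n.
Local Notation mu := (@lebesgue_rV R n).
Implicit Types (a b : 'I_n -> R) (f : V -> R) (K E Om : set V) (p q : R).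

Lemma measurable_halfspace (m : nat) :
  measurable (@halfspace R m).
Proof.
rewrite (_ : halfspace = (fun v : 'rV[R]_m.+1 => v ord0 ord_max) @^-1` `]0, +oo[%classic).
  by rewrite -[X in measurable X]setTI; exact: measurable_rV_coord.
by apply/seteqP; split => v /=; rewrite in_itv/= andbT.
Qed.

Lemma integral_restrict (Om K : set V) (F : V -> \bar R) :
  K `<=` Om -> (forall x, Om x -> ~ K x -> F x = 0%E) ->
  (\int[mu]_(x in Om) F x = \int[mu]_(x in K) F x)%E.
Proof.
move=> KO F0; rewrite [LHS]integral_mkcond [RHS]integral_mkcond.
apply: eq_integral => x _; rewrite !patchE.
case: ifPn => xO; case: ifPn => xK //.
- by apply: F0; [rewrite inE in xO|rewrite notin_setE in xK].
- by rewrite notin_setE in xO; rewrite inE in xK; have /xO := KO _ xK.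
Qed.

Lemma finite_norm1_integrable K f : measurable K -> measurable_fun K f ->
  finite_norm mu 1%E (f \_ K) -> mu.-integrable K (EFin \o f).
Proof.
move=> mK mf; rewrite /finite_norm Lnorm1 => Hf.
apply/integrableP; split; first exact/measurable_EFinP.
rewrite integral_mkcond; apply: le_lt_trans Hf.
rewrite le_eqVlt; apply/orP; left; apply/eqP; apply: eq_integral => x _ /=.
by rewrite !patchE; case: ifPn => //; rewrite normr0.
Qed.

Lemma finite_norm_powR_integrable p K f : 0 < p -> measurable K -> measurable_fun K f ->
  finite_norm mu p%:E (f \_ K) -> mu.-integrable K (EFin \o (fun x => `|f x| `^ p)).
Proof.
move=> p0 mK mf Hf; apply/integrableP; split.
  apply/measurable_EFinP; apply: (@measurableT_comp _ _ _ _ _ _ (fun t => t `^ p)).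
    exact: measurable_powR.
  exact: measurableT_comp.
have : ('N[mu]_p%:E[EFin \o (f \_ K)] `^ p < +oo)%E by exact: poweR_lty.
rewrite powR_Lnorm ?gt_eqF//; apply: le_lt_trans.
rewrite [leLHS]integral_mkcond le_eqVlt; apply/orP; left; apply/eqP; apply: eq_integral => x _ /=.
rewrite !patchE; case: ifPn => _ /=; last by rewrite normr0 powR0 ?gt_eqF.
by rewrite ger0_norm ?powR_ge0.
Qed.

Lemma integrable_mul_bounded K (h f : V -> R) (C : R) : measurable K ->
  mu.-integrable K (EFin \o h) -> measurable_fun K f ->
  (forall x, K x -> `|f x| <= C) ->
  mu.-integrable K (EFin \o (fun x => h x * f x)).
Proof.
move=> mK ih mf fC; have mh := measurable_int _ ih.
have iCh := integrableZl mK C (integrable_abse ih).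
apply: (le_integrable mK _ _ iCh).
  by apply/measurable_EFinP; apply: measurable_funM => //; exact/measurable_EFinP.
move=> x Kx; rewrite /= lee_fin normrM [leRHS]ger0_norm.
  by rewrite mulrC ler_wpM2r// fC.
by rewrite mulr_ge0// (le_trans _ (fC _ Kx)).
Qed.

Lemma integrable_mul_continuous a b (h f : V -> R) (K := cbox a b) :
  mu.-integrable K (EFin \o h) -> continuous f ->
  mu.-integrable K (EFin \o (fun x => h x * f x)).
Proof.
move=> ih cf; have [A KA] := @cbox_cube R n a b.
have [C C0 fC] := continuous_bounded_cube A cf.
apply: (@integrable_mul_bounded _ _ _ C) => //; first exact: measurable_cbox.
  by apply: measurable_funS (continuous_measurable_rV cf).
by move=> x /KA; exact: fC.
Qed.

Lemma Lp_loc_integrable Om f a b : measurable Om -> cbox a b `<=` Om ->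
  Lp_loc Om 1%E f -> mu.-integrable (cbox a b) (EFin \o f).
Proof.
move=> mOm abO [mf /(_ _ (@compact_cbox R n a b) abO) Hf].
apply: finite_norm1_integrable Hf; first exact: measurable_cbox.
by apply: measurable_funS mf.
Qed.

(** Shifting u by a constant does not change the weak gradient because the partial
    derivatives of a test function have zero integral. The difference of the two
    gradients is then orthogonal to all test functions. *)
Lemma weak_gradient_unique Om a b (u1 u2 : V -> R) (g1 g2 : V -> V) (c : R) i :
  measurable Om -> cbox a b `<=` Om ->
  weak_gradient Om u1 g1 -> weak_gradient Om u2 g2 ->
  ae_eq mu (cbox a b) u1 (fun x => u2 x - c) ->
  ae_eq mu (obox a b) (fun x => g1 x ord0 i) (fun x => g2 x ord0 i).
Proof.
move=> mOm abO [Lu1 Lg1 W1] [Lu2 Lg2 W2] u12.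
have mK : measurable (cbox a b : set V) := @measurable_cbox R n a b.
have mE : measurable (obox a b : set V) := @measurable_obox R n a b.
have EK := @obox_cbox R n a b.
have iu1 := Lp_loc_integrable mOm abO Lu1.
have iu2 := Lp_loc_integrable mOm abO Lu2.
have ig1 := Lp_loc_integrable mOm abO (Lg1 i).
have ig2 := Lp_loc_integrable mOm abO (Lg2 i).
have igE (g : V -> R) : mu.-integrable (cbox a b) (EFin \o g) ->
  mu.-integrable (obox a b) (EFin \o g) by exact: integrableS.
suff : ae_eq mu (obox a b) (EFin \o (fun x => g1 x ord0 i - g2 x ord0 i)) (cst 0%E).
  by apply: filterS => x H Ex; have [] := H Ex; move/eqP; rewrite subr_eq0 => /eqP.
apply: fundamental_lemma_variations.
  by have := integrableB mE (igE _ ig1) (igE _ ig2).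
move=> psi Cpsi psi0.
have Hpsi := C1_hasgrad Cpsi.
have cpsi := hasgrad_continuous Hpsi.
have cdpsi : continuous (fun x => grad psi x ord0 i) by exact: hasgrad_coordc Hpsi.
have gpsi0 x : ~ cbox a b x -> grad psi x ord0 i = 0.
  by move=> xab; rewrite (grad_off_obox psi0 xab) mxE.
have C1cpsi : C1c Om psi := C1c_obox Cpsi psi0 abO.
have restr (f h : V -> R) : (forall x, ~ cbox a b x -> h x = 0) ->
   (\int[mu]_(x in Om) (f x * h x)%:E = \int[mu]_(x in cbox a b) (f x * h x)%:E)%E.
  by move=> h0; apply: integral_restrict => // x _ xK; rewrite h0// mulr0.
have psiK x : ~ cbox a b x -> psi x = 0 by move=> xK; apply: psi0 => /EK.
have e1 := W1 _ i C1cpsi; have e2 := W2 _ i C1cpsi.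
rewrite (restr _ _ gpsi0) (restr _ _ psiK) in e1.
rewrite (restr _ _ gpsi0) (restr _ _ psiK) in e2.
have i0 : (\int[mu]_(x in cbox a b) (grad psi x ord0 i)%:E = 0)%E.
  have [A KA] := @cbox_cube R n a b.
  rewrite -(@integral_restrict setT)//; last by move=> x _ /gpsi0 ->.
  apply: (@integral_partial_eq0 R n psi _ i A) => //.
  - by move=> x; exact: hasgrad_is_derive.
  - by move=> x xA; apply: psiK => /KA.
  - by move=> x xA; apply: gpsi0 => /KA.
have i1 := integrable_mul_continuous iu2 cdpsi.
have idpsi : mu.-integrable (cbox a b) (EFin \o (fun x => grad psi x ord0 i)).
  have i1c : mu.-integrable (cbox a b) (EFin \o cst 1).
    by apply: (@bounded_integrable _ _ _ _ 1) => //; [exact: cbox_fin|move=> x _; rewrite normr1].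
  have := integrable_mul_continuous i1c cdpsi.
  by congr (integrable _ _ _); apply/funext => x /=; rewrite mul1r.
have i2 := integrableZl mK c idpsi.
have e3 : (\int[mu]_(x in cbox a b) (u1 x * grad psi x ord0 i)%:E =
  \int[mu]_(x in cbox a b) (u2 x * grad psi x ord0 i)%:E)%E.
  transitivity (\int[mu]_(x in cbox a b) ((u2 x * grad psi x ord0 i)%:E -
     (c * grad psi x ord0 i)%:E))%E.
    apply: ae_eq_integral => //.
    - exact: measurable_int (integrable_mul_continuous iu1 cdpsi).
    - exact: measurable_int (integrableB mK i1 i2).
    - apply: filterS u12 => x H Kx; rewrite (H Kx) -EFinB; congr (_%:E); ring.
  by rewrite (integralB mK i1 i2) /= integralZl// i0 mule0 sube0.
have e4 : (\int[mu]_(x in cbox a b) (g1 x ord0 i * psi x)%:E =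
           \int[mu]_(x in cbox a b) (g2 x ord0 i * psi x)%:E)%E.
  by apply: oppe_inj; rewrite -e1 -e2 e3.
have i3 := integrable_mul_continuous ig1 cpsi.
have i4 := integrable_mul_continuous ig2 cpsi.
rewrite -(@integral_restrict (cbox a b))//; last by move=> x _ /psi0 ->; rewrite mulr0.
under eq_integral do rewrite mulrBl EFinB.
rewrite (integralB mK i3 i4) /= e4 subee//.
exact: integrable_fin_num i4.
Qed.

End localization.

(** * Growth of the flux and Hoelder's inequality *)

Section weights.
Context {R : realType} {n : nat}.
Local Notation V := 'rV[R]_n.
Local Notation mu := (@lebesgue_rV R n).
Implicit Types (f : V -> R) (K E Om : set V) (p q : R) (g h : V -> V).

Lemma measurable_fun_div E (f1 f2 : V -> R) :
  measurable_fun E f1 -> measurable_fun E f2 ->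
  measurable_fun E (fun x => f1 x / f2 x).
Proof.
move=> mf1 mf2; apply: measurable_funM => //.
(* The inverse is written with a power function; both sides vanish where f2 does. *)
rewrite (_ : (fun x => _) = (fun x => (f2 x ^+ 2) `^ (-1) * f2 x)); last first.
  apply/funext => x; rewrite powR_inv1 ?sqr_ge0//.
  have [->|f0] := eqVneq (f2 x) 0; first by rewrite mulr0 invr0.
  by rewrite expr2 invfM -mulrA mulVf// mulr1.
apply: measurable_funM => //.
apply: (@measurableT_comp _ _ _ _ _ _ (fun t => t `^ (-1))).
  exact: measurable_powR.
by apply: measurable_funX.
Qed.

Definition measurable_field E g := forall i, measurable_fun E (fun x => g x ord0 i).

Lemma measurable_dotv E g h : measurable_field E g -> measurable_field E h ->
  measurable_fun E (fun x => dotv (g x) (h x)).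
Proof.
move=> mg mh; rewrite /dotv; apply: measurable_sum => i.
exact: measurable_funM.
Qed.

Lemma measurable_enorm E g : measurable_field E g ->
  measurable_fun E (fun x => enorm (g x)).
Proof.
move=> mg; change (measurable_fun E (@Num.sqrt R \o (fun x => dotv (g x) (g x)))).
apply: measurableT_comp; last exact: measurable_dotv.
by apply: continuous_measurable_fun; exact: sqrt_continuous.
Qed.

Lemma measurable_enorm_powR E g q : measurable_field E g ->
  measurable_fun E (fun x => enorm (g x) `^ q).
Proof.
move=> mg; apply: (@measurableT_comp _ _ _ _ _ _ (fun t => t `^ q)).
  exact: measurable_powR.
exact: measurable_enorm.
Qed.

Lemma measurable_pflux E p g h : measurable_field E g -> measurable_field E h ->
  measurable_fun E (fun x => dotv (pflux p (g x)) (h x)).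
Proof.
move=> mg mh; under eq_fun do rewrite pfluxE.
by apply: measurable_funM; [exact: measurable_enorm_powR|exact: measurable_dotv].
Qed.

Lemma continuous_field E g : continuous g -> measurable_field E g.
Proof.
move=> cg i; apply: (@measurable_funS _ _ _ _ setT) => //.
apply: continuous_measurable_rV => x.
by apply: (@continuous_comp _ _ _ g (fun v : V => v ord0 i)); [exact: cg|exact: coord_continuous].
Qed.

Lemma continuous_field_bounded g (A : R) : continuous g ->
  exists2 C : R, 0 <= C & forall x, cube A x -> enorm (g x) <= C.
Proof.
move=> cg.
have H i : exists C : R, forall x, cube A x -> `|g x ord0 i| <= C.
  have cgi : continuous (fun x => g x ord0 i).
    move=> x; apply: (@continuous_comp _ _ _ g (fun v : V => v ord0 i)); first exact: cg.
    exact: coord_continuous.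
  by have [C _ HC] := continuous_bounded_cube A cgi; exists C.
have [C HC] := choice H.
exists `|\sum_i C i| => // x Ax.
rewrite (le_trans (enorm_le_sum _))// (le_trans _ (ler_norm _))//.
by apply: ler_sum => i _; exact: HC.
Qed.

(** Each coordinate is at most the l^p norm of v. *)
Lemma enorm_powR_le p (v : V) : 0 < p ->
  enorm v `^ p <= n%:R `^ p * \sum_i `|v ord0 i| `^ p.
Proof.
move=> p0; set s := \sum_i _.
have s0 : 0 <= s by apply: sumr_ge0 => i _; exact: powR_ge0.
have vs i : `|v ord0 i| <= s `^ p^-1.
  have {1}-> : `|v ord0 i| = (`|v ord0 i| `^ p) `^ p^-1.
    by rewrite -powRrM divff ?gt_eqF// powRr1.
  apply: ge0_ler_powR; rewrite ?nnegrE ?powR_ge0 ?invr_ge0 ?(ltW p0)//.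
  by rewrite /s (bigD1 i)//= lerDl sumr_ge0// => j _; exact: powR_ge0.
have -> : s = (s `^ p^-1) `^ p by rewrite -powRrM mulVf ?gt_eqF// powRr1.
rewrite -powRM ?powR_ge0//.
apply: ge0_ler_powR; rewrite ?nnegrE ?enorm_ge0 ?mulr_ge0 ?powR_ge0 ?(ltW p0)//.
rewrite (le_trans (enorm_le_sum _))// (le_trans (ler_sum _ (fun i _ => vs i)))//.
by rewrite sumr_const card_ord mulr_natl.
Qed.

Lemma enorm_powR_integrable E p g : 0 < p -> measurable E -> measurable_field E g ->
  (forall i, mu.-integrable E (EFin \o (fun x => `|g x ord0 i| `^ p))) ->
  mu.-integrable E (EFin \o (fun x => enorm (g x) `^ p)).
Proof.
move=> p0 mE mg ig.
have iS : mu.-integrable E (fun x => (n%:R `^ p)%:E * \sum_(i < n) (`|g x ord0 i| `^ p)%:E)%E.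
  by apply: integrableZl => //; apply: integrable_sum => // i _; exact: ig.
apply: (le_integrable mE _ _ iS).
  by apply/measurable_EFinP; exact: measurable_enorm_powR.
move=> x Ex; rewrite /= sumEFin -EFinM /= lee_fin !ger0_norm ?powR_ge0//.
  exact: enorm_powR_le.
by rewrite mulr_ge0 ?powR_ge0// sumr_ge0// => i _; exact: powR_ge0.
Qed.

(** It dominates |pflux p g| and is at least 1, so that one weighted
    L1 norm controls all the error terms of the comparison. *)
Definition weight p g x := 1 + enorm (g x) `^ (p - 1).

Lemma weight_ge1 p g x : 1 <= weight p g x.
Proof. by rewrite /weight lerDl powR_ge0. Qed.

Lemma measurable_weight E p g : measurable_field E g -> measurable_fun E (weight p g).
Proof.
move=> mg; apply: measurable_funD => //; exact: measurable_enorm_powR.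
Qed.

(** The exponent p / (p - 1) is conjugate to p, and (|g|^(p-1))^(p/(p-1)) = |g|^p. *)
Lemma weight_finite_norm p E g : 1 < p -> measurable E -> (mu E < +oo)%E ->
  measurable_field E g ->
  (forall i, mu.-integrable E (EFin \o (fun x => `|g x ord0 i| `^ p))) ->
  finite_norm mu (p / (p - 1))%:E (weight p g \_ E).
Proof.
move=> p1 mE Eoo mg ig; have p0 : 0 < p by rewrite (lt_trans _ p1).
have p10 : 0 < p - 1 by rewrite subr_gt0.
have oneE : 1 `^ (p - 1) = 1 by rewrite powR1.
set q := p / (p - 1); have q0 : 0 < q by rewrite divr_gt0.
rewrite /finite_norm unlock /= poweR_lty//.
have i1 : mu.-integrable E (EFin \o cst 1).
  by apply: (@bounded_integrable _ _ _ _ 1) => // x _; rewrite normr1.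
have i2 := enorm_powR_integrable p0 mE mg ig.
have i3 := integrableZl mE (2 `^ q) (integrableD mE i1 i2).
have : mu.-integrable E (EFin \o (fun x => weight p g x `^ q)).
  apply: (le_integrable mE _ _ i3).
    apply/measurable_EFinP; apply: (@measurableT_comp _ _ _ _ _ _ (fun t => t `^ q)).
      exact: measurable_powR.
    exact: measurable_weight.
  move=> x Ex /=; rewrite lee_fin !ger0_norm ?mulr_ge0 ?addr_ge0 ?powR_ge0//.
  have t0 := enorm_ge0 (g x); rewrite /weight; set t := enorm (g x) in t0 *.
  (* The two cases bound weight^q by 2^q and by 2^q t^p respectively. *)
  have [t1|/ltW t1] := leP t 1.
    apply: (@le_trans _ _ (2 `^ q)); last by rewrite ler_peMr ?powR_ge0// lerDl powR_ge0.
    apply: ge0_ler_powR; rewrite ?nnegrE ?addr_ge0 ?powR_ge0 ?(ltW q0)//.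
    rewrite -[2]/(1 + 1) lerD2l -[leRHS]oneE.
    by apply: ge0_ler_powR; rewrite ?nnegrE ?(ltW p10).
  have tp : 1 <= t `^ (p - 1).
    rewrite -[leLHS]oneE.
    by apply: ge0_ler_powR; rewrite ?nnegrE ?(ltW p10).
  apply: (@le_trans _ _ ((2 * t `^ (p - 1)) `^ q)).
    apply: ge0_ler_powR; rewrite ?(ltW q0) ?nnegrE ?addr_ge0 ?mulr_ge0 ?powR_ge0//.
    by move: tp; lra.
  rewrite powRM ?powR_ge0// -powRrM /q mulrCA divff ?gt_eqF// mulr1.
  by rewrite ler_wpM2l ?powR_ge0// lerDr.
move=> /integrableP[_]; apply: le_lt_trans.
rewrite [leRHS]integral_mkcond le_eqVlt; apply/orP; left; apply/eqP; apply: eq_integral => x _ /=.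
rewrite !patchE; case: ifPn => _ /=; last by rewrite normr0 powR0 ?gt_eqF.
rewrite [in RHS]ger0_norm ?powR_ge0// ger0_norm//.
by rewrite (le_trans _ (weight_ge1 _ _ _)).
Qed.

Lemma weighted_hoelder E Om p q f (b : V -> R) :
  0 < p -> 0 < q -> p^-1 + q^-1 = 1 -> measurable E -> measurable Om -> E `<=` Om ->
  measurable_fun E b -> measurable_fun Om f ->
  (\int[mu]_(x in E) `|b x * f x|%:E <=
    'N[mu]_q%:E[EFin \o (b \_ E)] * 'N[mu]_p%:E[EFin \o (f \_ Om)])%E.
Proof.
move=> p0 q0 pq mE mOm EO mb mf.
have mb' : measurable_fun setT (b \_ E) by apply/(measurable_restrictT _ mE).
have mf' : measurable_fun setT (f \_ Om) by apply/(measurable_restrictT _ mOm).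
apply: le_trans (hoelder mu mb' mf' q0 p0 _); last by rewrite addrC.
rewrite Lnorm1 [leLHS]integral_mkcond le_eqVlt; apply/orP; left; apply/eqP.
apply: eq_integral => x _ /=; rewrite !patchE.
case: ifPn => [xE|_]; last by rewrite mul0r normr0.
by rewrite ifT// inE; apply: EO; rewrite inE in xE.
Qed.

End weights.

(** * Approximation of weak solutions by C1 functions *)

Section approximation.
Context {R : realType} {n : nat}.
Local Notation V := 'rV[R]_n.+1.
Local Notation mu := (@lebesgue_rV R n.+1).
Implicit Types (a b : 'I_n.+1 -> R) (p m : R) (u U : V -> R) (g : V -> V).

Lemma ess_inf_pos u (K : set V) : (0 < ess_inf_on K u)%E ->
  exists2 m : R, 0 < m & {ae mu, forall x, K x -> m <= u x}.
Proof.
move=> H.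
have [m m0 mH] : exists2 m : R, 0 < m & (m%:E <= ess_inf_on K u)%E.
  case: (ess_inf_on K u) H => [r|//|//]; first by rewrite lte_fin => r0; exists r.
  by move=> _; exists 1 => //; rewrite leey.
exists m => //; move/ess_infP : mH; apply: filterS => x + Kx.
by rewrite /patch ifT ?inE//= lee_fin.
Qed.

(** What the comparison uses of a weak solution on a box E. The representative U is
    at least m at every point, which spares all exceptional sets later, and the
    C1 functions v are close to it in the norm with the weight of the flux. *)
Definition normalized_solution p (E : set V) m U g :=
  [/\ [/\ measurable_fun E U, forall x, m <= U x, measurable_field E g &
      forall i, mu.-integrable E (EFin \o (fun x => `|g x ord0 i| `^ p))],
    forall psi, C1 psi -> (forall x, ~ E x -> psi x = 0) ->
      (forall x, ~ E x -> grad psi x = 0) ->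
      (\int[mu]_(x in E) (dotv (pflux p (g x)) (grad psi x))%:E =
       \int[mu]_(x in E) (psi x / U x)%:E)%E &
    forall e : R, 0 < e -> exists2 v, C1 v &
      (\int[mu]_(x in E) (weight p g x *
        (`|v x - U x| + \sum_i `|grad v x ord0 i - g x ord0 i|))%:E < e%:E)%E].

(** Let u >= m > 0 almost everywhere on the closed box and phi = 1 there. The
    boundary condition makes (u - m)^+ phi a limit of C1 functions in W^(1,p);
    adding m to them approximates u on the box. The gradient of the limit is the
    weak gradient of u by uniqueness, and Hoelder's inequality turns the
    convergence into one for the weighted L1 norm. *)
Lemma normalize_solution p u a b : 1 < p -> weak_solution p u -> cbox a b `<=` halfspace ->
  exists m U g, [/\ 0 < m, {ae mu, forall x, obox a b x -> U x = u x} &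
     normalized_solution p (obox a b) m U g].
Proof.
move=> p1 [Du [[Wu Lu LDu] inf_u eq_u bd_u]] abH.
have p0 : 0 < p by rewrite (lt_trans _ p1).
have p10 : 0 < p - 1 by rewrite subr_gt0.
set E : set V := obox a b; set K : set V := cbox a b.
have mE : measurable E := @measurable_obox R n.+1 a b.
have mK : measurable K := @measurable_cbox R n.+1 a b.
have mH : measurable (@halfspace R n) := @measurable_halfspace R n.
have EK : E `<=` K by exact: obox_cbox.
have EH : E `<=` halfspace by exact: subset_trans EK abH.
have [m m0 um] : exists2 m : R, 0 < m & {ae mu, forall x, K x -> m <= u x}.
  apply: ess_inf_pos; apply: inf_u; split.
    by rewrite -(closure_id _).1; [exact: compact_cbox|exact: closed_cbox].
  by rewrite -(closure_id _).1//; exact: closed_cbox.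
(* One unit of margin makes the bump equal to 1 on K. *)
pose phi : V -> R := bump 1 (fun i => a i - 1) (fun i => b i + 1).
have Cphi : C1c setT phi.
  apply: (@C1c_obox _ _ _ (fun i => a i - 1) (fun i => b i + 1)) => //.
    exact: bump_C1.
  by move=> y; exact: bump_off.
have phi1 x : K x -> phi x = 1.
  move=> Kx; rewrite /phi /bump big1// => i _; have /andP[ax xb] := Kx i.
  by rewrite !smoothstep_ge1 ?mulr1//; lra.
pose w : V -> R := (fun x => Num.max (u x - m) 0 * phi x) \_ halfspace.
have [g [Wg Lw Lg] appr] : W1p0 halfspace p w := bd_u phi m Cphi m0.
have wK x : K x -> w x = Num.max (u x - m) 0.
  by move=> Kx; rewrite /w patchE ifT ?inE; [rewrite phi1// mulr1|exact: abH].
(* On K the limit w of the C1 functions is U - m at every point, not only almost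
   everywhere. *)
pose U x := Num.max (u x - m) 0 + m.
have UE x : m <= U x by rewrite /U lerDr le_max lexx orbT.
have Uu : {ae mu, forall x, K x -> U x = u x}.
  by apply: filterS um => x H Kx; rewrite /U max_l ?subr_ge0 ?H// subrK.
have mDu i : measurable_fun halfspace (fun x => Du x ord0 i) by have [] := LDu i.
have mg i : measurable_fun halfspace (fun x => g x ord0 i) by have [] := Lg i.
have mu_u : measurable_fun halfspace u by have [] := Lu.
have gDu i : ae_eq mu E (fun x => g x ord0 i) (fun x => Du x ord0 i).
  apply: (@weak_gradient_unique _ _ halfspace a b w u g Du m i) => //.
  by apply: filterS Uu => x H Kx; rewrite wK// -[X in _ = X - m](H Kx) /U addrK.
have mEg : measurable_field E g by move=> i; exact: measurable_funS (mg i).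
have mEDu : measurable_field E Du by move=> i; exact: measurable_funS (mDu i).
have mEu : measurable_fun E u by exact: measurable_funS mu_u.
have mEU : measurable_fun E U.
  apply: measurable_funD => //; apply: measurable_maxr => //.
  exact: measurable_funB.
have ig i : mu.-integrable E (EFin \o (fun x => `|g x ord0 i| `^ p)).
  have [mgi fgi] := Lg i.
  apply: (@integrableS _ _ _ mu halfspace) => //.
  exact: finite_norm_powR_integrable.
exists m, U, g; split => //.
  by apply: filterS Uu => x H /EK; exact: H.
split => //.
- move=> psi Cpsi psi0 gpsi0.
  have := eq_u psi (C1c_obox Cpsi psi0 abH).
  rewrite (@integral_restrict _ _ _ E)//; last first.
    by move=> x _ xE; rewrite gpsi0// dotv0 mulr0.
  rewrite (@integral_restrict _ _ halfspace E)//; last first.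
    by move=> x _ xE; rewrite psi0// mul0r.
  have mdpsi : measurable_field E (grad psi) by apply: continuous_field; case: Cpsi.
  have mpsi : measurable_fun E psi.
    apply: (@measurable_funS _ _ _ _ setT) => //.
    by apply: continuous_measurable_rV; exact: hasgrad_continuous (C1_hasgrad Cpsi).
  have -> : (\int[mu]_(x in E) (enorm (Du x) `^ (p - 2) * dotv (Du x) (grad psi x))%:E =
    \int[mu]_(x in E) (dotv (pflux p (g x)) (grad psi x))%:E)%E.
    apply: ae_eq_integral => //.
    + apply/measurable_EFinP; apply: measurable_funM; first exact: measurable_enorm_powR.
      exact: measurable_dotv.
    + by apply/measurable_EFinP; exact: measurable_pflux.
    + have : {ae mu, forall x, forall i, E x -> g x ord0 i = Du x ord0 i}.
        by apply: filter_forall => i; exact: gDu.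
      apply: filterS => x H Ex; have -> : g x = Du x by apply/rowP => i; exact: H.
      by rewrite pfluxE.
  move=> ->; apply: ae_eq_integral => //.
  + by apply/measurable_EFinP; exact: measurable_fun_div.
  + by apply/measurable_EFinP; exact: measurable_fun_div.
  + by apply: filterS Uu => x H /EK/H ->.
- move=> e e0.
  set q := p / (p - 1).
  have q0 : 0 < q by rewrite divr_gt0.
  have pq : p^-1 + q^-1 = 1 by rewrite /q invf_div; field; rewrite !gt_eqF.
  set b0 := weight p g.
  have mb0 : measurable_fun E b0 by exact: measurable_weight.
  have Eoo : (mu E < +oo)%E by exact: obox_fin.
  have := weight_finite_norm p1 mE Eoo mEg ig; rewrite -/q -/b0 /finite_norm.
  set Nb := ('N[mu]_q%:E[_])%E => Nboo.
  have Nb0 : (0 <= Nb)%E by exact: Lnorm_ge0.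
  have NbE : Nb = (fine Nb)%:E by rewrite fineK// ge0_fin_numE.
  (* The weight has finite norm Nb for the conjugate exponent, hence this precision. *)
  pose e' := e / (fine Nb + 1).
  have fNb0 : 0 <= fine Nb by exact: fine_ge0.
  have e'0 : 0 < e' by rewrite divr_gt0// ltr_pwDr.
  have [ps Cps psE] := appr _ e'0.
  have Hps : hasgrad ps (grad ps) by case: Cps => /C1_hasgrad.
  have Hv := hasgradD Hps (hasgrad_cst m).
  exists (fun x => ps x + m); first exact: hasgrad_C1 Hv.
  pose f0 x := ps x - w x.
  pose f i x := grad ps x ord0 i - g x ord0 i.
  have mps : measurable_fun halfspace ps.
    apply: (@measurable_funS _ _ _ _ setT) => //.
    by apply: continuous_measurable_rV; exact: hasgrad_continuous Hps.
  have mf0 : measurable_fun halfspace f0.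
    by apply: measurable_funB => //; case: Lw.
  have mf i : measurable_fun halfspace (f i).
    apply: measurable_funB => //.
    by move: i; apply: continuous_field; case: Hps.
  have -> : (\int[mu]_(x in E) (b0 x * (`|ps x + m - U x| +
      \sum_i `|grad (fun x => (ps x + m)%R) x ord0 i - g x ord0 i|))%:E =
    \int[mu]_(x in E) `|b0 x * f0 x|%:E + \sum_i \int[mu]_(x in E) `|b0 x * f i x|%:E)%E.
    rewrite -ge0_integral_sum//; last first.
      move=> i; apply/measurable_EFinP; apply: measurableT_comp => //.
      by apply: measurable_funM => //; exact: measurable_funS (mf i).
    rewrite -ge0_integralD//; last 3 first.
    - apply/measurable_EFinP; apply: measurableT_comp => //.
      by apply: measurable_funM => //; exact: measurable_funS mf0.
    - by move=> x _; apply: sume_ge0 => i _.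
    - apply: emeasurable_sum => i; apply/measurable_EFinP; apply: measurableT_comp => //.
      by apply: measurable_funM => //; exact: measurable_funS (mf i).
    apply: eq_integral => x; rewrite inE => Ex.
    rewrite sumEFin -EFinD; congr (_%:E).
    have b00 : 0 <= b0 x by rewrite (le_trans _ (weight_ge1 _ _ _)).
    rewrite mulrDr mulr_sumr normrM (ger0_norm b00); congr (_ * `| _ | + _).
      by rewrite /f0 wK ?/U; [ring|exact: EK].
    apply: eq_bigr => i _; rewrite normrM (ger0_norm b00); congr (_ * `| _ |).
    have [_ -> _] := Hv.
    by rewrite addr0.
  have holder := weighted_hoelder p0 q0 pq mE mH EH mb0.
  apply: (@le_lt_trans _ _ (Nb * W1p_norm halfspace p (ps \- w)%R (grad ps \- g)%R)%E).
    rewrite /W1p_norm ge0_muleDr; [|exact: Lnorm_ge0|by apply: sume_ge0 => i _; exact: Lnorm_ge0].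
    rewrite ge0_sume_distrr; last by move=> i _; exact: Lnorm_ge0.
    apply: leeD; first exact: holder.
    apply: lee_sum => i _; apply: le_trans (holder _ (mf i)) _.
    rewrite le_eqVlt; apply/orP; left; apply/eqP; congr (_ * Lnorm _ _ (_ \o (_ \_ _)))%E.
    by apply/funext => x; rewrite /f !mxE.
  rewrite NbE; apply: (@le_lt_trans _ _ ((fine Nb)%:E * e'%:E)%E).
    by apply: lee_wpmul2l; [rewrite lee_fin|exact: ltW].
  rewrite -EFinM lte_fin /e' mulrA ltr_pdivrMr ?ltr_pwDr//.
  by rewrite mulrC ltr_pM2l// ltrDl.
Qed.

End approximation.

(** * Comparison with a subsolution of class C1 *)

Section comparison.
Context {R : realType} {n : nat}.
Local Notation V := 'rV[R]_n.+1.
Local Notation mu := (@lebesgue_rV R n.+1).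
Implicit Types (a b : 'I_n.+1 -> R) (p m : R) (U w eta : V -> R) (g : V -> V).

(** The test function is psi = etax S(w - v), with gradient gpsi. Replacing v by U
    in the zero order terms costs a multiple of |v - U|. In the flux terms,
    splitting wg - vg = (wg - g) + (g - vg) leaves a monotone term of good sign and
    an error bounded by |g - vg|. Where the cutoff varies, w <= m <= U, so
    S(w - v) is itself at most 2 |v - U|. *)
Lemma barrier_comparison_pointwise p m (wx Ux vx etax w0 Ch Cg Ce : R) (wg g vg etag : V) :
  1 < p -> 0 < m -> m <= Ux -> 0 < w0 -> 0 <= etax <= Ch ->
  (etax != 0 -> w0 <= wx) -> (etag != 0 -> wx <= m) ->
  enorm wg <= Cg -> enorm etag <= Ce ->
  forall gpsi Cb,
  gpsi = etax *: (dsmoothstep (wx - vx) *: (wg - vg)) + smoothstep (wx - vx) *: etag ->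
  Cb = 1 + Cg `^ (p - 1) ->
  (etax * smoothstep (wx - vx) / wx - dotv (pflux p wg) gpsi) -
  (etax * smoothstep (wx - vx) / Ux - dotv (pflux p g) gpsi) <=
  etax * smoothstep (wx - Ux) * (wx^-1 - Ux^-1) +
  (2 * Ch * (w0^-1 + m^-1) + 2 * Ch * Cb + 2 * Cb * Ce) *
   ((1 + enorm g `^ (p - 1)) * (`|vx - Ux| + \sum_i `|vg ord0 i - g ord0 i|)).
Proof.
move=> p1 m0 mU w00 /andP[eta0 etaC] etaw etagm wgC etagC gpsi Cb gpsiE CbE.
have p10 : 0 <= p - 1 by rewrite subr_ge0 ltW.
set P := pflux p wg; set Q := pflux p g.
set B := dotv (P - Q).
set t := enorm g `^ (p - 1); have t0 : 0 <= t by exact: powR_ge0.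
set d := `|vx - Ux|; have d0 : 0 <= d by exact: normr_ge0.
set D := \sum_i _; have D0 : 0 <= D by exact: sumr_ge0.
have Cgp0 : 0 <= Cg `^ (p - 1) by exact: powR_ge0.
have Cg0 : 0 <= Cg by rewrite (le_trans _ wgC) ?enorm_ge0.
have Cb0 : 0 <= Cb by rewrite CbE addr_ge0.
have Ce0 : 0 <= Ce by rewrite (le_trans _ etagC) ?enorm_ge0.
have Ch0 : 0 <= Ch by rewrite (le_trans _ etaC).
have Bz z : `|B z| <= Cb * (1 + t) * enorm z.
  rewrite /B dotvDl dotvNl (le_trans (ler_normB _ _))//.
  have h1 := dotv_norm_le P z; have h2 := dotv_norm_le Q z.
  rewrite !enorm_pflux// in h1 h2.
  have h3 : enorm wg `^ (p - 1) <= Cg `^ (p - 1).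
    by apply: ge0_ler_powR; rewrite ?nnegrE ?enorm_ge0.
  have z0 := enorm_ge0 z.
  apply: (@le_trans _ _ ((Cg `^ (p - 1) + t) * enorm z)).
    rewrite mulrDl; apply: lerD => //.
    by apply: le_trans h1 _; exact: ler_wpM2r.
  apply: ler_wpM2r => //; rewrite CbE; nra.
have stepU : `|smoothstep (wx - vx) - smoothstep (wx - Ux)| <= 2 * d.
  apply: le_trans (smoothstep_lipschitz _ _) _.
  by rewrite (_ : wx - vx - (wx - Ux) = - (vx - Ux)) ?normrN//; ring.
have -> : etax * smoothstep (wx - vx) / wx - dotv P gpsi - (etax * smoothstep (wx - vx) / Ux - dotv Q gpsi) =
   etax * smoothstep (wx - vx) * (wx^-1 - Ux^-1) - B gpsi.
  by rewrite /B dotvDl dotvNl; ring.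
have Ui0 : 0 <= Ux^-1 <= m^-1.
  by rewrite invr_ge0 (le_trans (ltW m0) mU)/= lef_pV2 ?posrE// (lt_le_trans m0).
have mi0 : 0 < m^-1 by rewrite invr_gt0.
have wi0 : 0 < w0^-1 by rewrite invr_gt0.
have T1 : etax * smoothstep (wx - vx) * (wx^-1 - Ux^-1) <=
   etax * smoothstep (wx - Ux) * (wx^-1 - Ux^-1) + 2 * Ch * (w0^-1 + m^-1) * d.
  have [->|etaN0] := eqVneq etax 0.
    by rewrite !mul0r add0r !mulr_ge0// addr_ge0// ltW.
  have ww := etaw etaN0.
  have wI : 0 <= wx^-1 <= w0^-1.
    by rewrite invr_ge0 (le_trans (ltW w00) ww)/= lef_pV2 ?posrE// (lt_le_trans w00).
  rewrite -lerBlDl -mulrBl -mulrBr (le_trans (ler_norm _))// normrM normrM (ger0_norm eta0).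
  have h : `|wx^-1 - Ux^-1| <= w0^-1 + m^-1.
    by rewrite ler_norml; apply/andP; split; lra.
  rewrite -[leRHS]mulrA [_ * d]mulrC mulrA.
  apply: ler_pM => //; first by rewrite mulr_ge0.
  by rewrite [2 * _]mulrC -mulrA; apply: ler_pM.
have T2 : - B gpsi <= 2 * Ch * (Cb * (1 + t) * D) + 2 * d * (Cb * (1 + t) * Ce).
  rewrite gpsiE /B dotvDr !dotvZr -/B opprD.
  have ds := dsmoothstep_itv (wx - vx); have ss := smoothstep_itv (wx - vx).
  apply: lerD.
    have -> : wg - vg = (wg - g) + (g - vg) by rewrite addrA subrK.
    have mono : 0 <= B (wg - g) by exact: pflux_monotone.
    have hD : enorm (g - vg) <= D.
      rewrite (le_trans (enorm_le_sum _))//; apply: ler_sum => i _.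
      by rewrite !mxE distrC.
    have h : - B (g - vg) <= Cb * (1 + t) * D.
      rewrite (le_trans (ler_norm _))// normrN (le_trans (Bz _))//.
      by apply: ler_wpM2l => //; rewrite mulr_ge0// addr_ge0.
    rewrite /B dotvDr -/B.
    have k0 : 0 <= Cb * (1 + t) * D by rewrite !mulr_ge0// addr_ge0.
    have e1 : etax * dsmoothstep (wx - vx) <= 2 * Ch.
      by rewrite mulrC; case/andP: ds => ? ?; apply: ler_pM.
    have e0 : 0 <= etax * dsmoothstep (wx - vx) by case/andP: ds => ? ?; rewrite mulr_ge0.
    rewrite mulrA -mulrN.
    apply: (@le_trans _ _ (etax * dsmoothstep (wx - vx) * (Cb * (1 + t) * D))).
      by apply: ler_wpM2l => //; lra.
    exact: ler_wpM2r.
  have [->|etagN0] := eqVneq etag 0.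
    by rewrite /B dotv0 mulr0 oppr0 !mulr_ge0// addr_ge0.
  have wm := etagm etagN0.
  have s0 : smoothstep (wx - Ux) = 0 by rewrite smoothstep_le0//; lra.
  rewrite s0 subr0 in stepU.
  rewrite (le_trans (ler_norm _))// normrN normrM.
  apply: ler_pM => //; apply: le_trans (Bz _) _.
  by apply: ler_wpM2l => //; rewrite mulr_ge0// addr_ge0.
apply: (le_trans (lerD T1 T2)); rewrite -addrA lerD2l.
have td : d <= (1 + t) * d by nra.
have k1 : 0 <= 2 * Ch * (w0^-1 + m^-1) by rewrite !mulr_ge0// addr_ge0// ltW.
have k2 : 0 <= 2 * Ch * Cb by rewrite !mulr_ge0.
have k3 : 0 <= 2 * Cb * Ce by rewrite !mulr_ge0.
have tD0 : 0 <= (1 + t) * D by rewrite mulr_ge0// addr_ge0.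
have td0 : 0 <= (1 + t) * d by rewrite mulr_ge0// addr_ge0.
have c1td := ler_wpM2l k1 td.
have := mulr_ge0 k1 tD0; have := mulr_ge0 k2 td0; have := mulr_ge0 k3 tD0.
move: c1td; set c1 := 2 * Ch * (w0^-1 + m^-1) => h1 h2 h3 h4.
rewrite [leLHS](_ : _ = c1 * d + (2 * Ch * Cb * ((1 + t) * D) + 2 * Cb * Ce * ((1 + t) * d))).
  rewrite [leRHS](_ : _ = c1 * ((1 + t) * d) + c1 * ((1 + t) * D) +
     (2 * Ch * Cb * ((1 + t) * d) + 2 * Ch * Cb * ((1 + t) * D)) +
     (2 * Cb * Ce * ((1 + t) * d) + 2 * Cb * Ce * ((1 + t) * D))); last by ring.
  lra.
by ring.
Qed.

Lemma weight_integrable p (E : set V) g : 1 < p -> measurable E -> (mu E < +oo)%E ->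
  measurable_field E g ->
  (forall i, mu.-integrable E (EFin \o (fun x => `|g x ord0 i| `^ p))) ->
  mu.-integrable E (EFin \o weight p g).
Proof.
move=> p1 mE Eoo mg ig; have p0 : 0 < p by rewrite (lt_trans _ p1).
have i1 : mu.-integrable E (EFin \o cst 2).
  by apply: (@bounded_integrable _ _ _ _ 2) => // x _ /=; rewrite ger0_norm.
have i2 := integrableD mE i1 (enorm_powR_integrable p0 mE mg ig).
apply: (le_integrable mE _ _ i2).
  by apply/measurable_EFinP; exact: measurable_weight.
move=> x Ex /=; rewrite lee_fin ger0_norm ?(le_trans _ (weight_ge1 _ _ _))//.
rewrite ger0_norm ?addr_ge0 ?powR_ge0// /weight.
have t0 := enorm_ge0 (g x); set t := enorm (g x) in t0 *.
have [t1|/ltW t1] := leP t 1.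
  have : t `^ (p - 1) <= 1.
    rewrite -[leRHS](_ : 1 `^ (p - 1) = 1); last by rewrite powR1.
    by apply: ge0_ler_powR; rewrite ?nnegrE ?subr_ge0 ?(ltW p1).
  by have := powR_ge0 t p; lra.
have : t `^ (p - 1) <= t `^ p by apply: ler_powR => //; rewrite gerBl.
lra.
Qed.

(** The cutoff eta keeps the test function eta S(w - v) inside the region where w is
    bounded below; where it varies, w <= m <= U, so that it produces no boundary
    term in the limit. Subtracting the two weak inequalities bounds the integral of
    the nonnegative function eta S(w - U) (1/U - 1/w) by an arbitrarily small
    constant. *)
Lemma barrier_comparison p a b m U g w wg eta etag (w0 : R) (E := obox a b : set V) :
  1 < p -> 0 < m -> normalized_solution p E m U g ->
  hasgrad w wg -> hasgrad eta etag -> (forall x, 0 <= eta x) ->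
  (forall x, ~ E x -> eta x = 0) -> (forall x, ~ E x -> etag x = 0) ->
  0 < w0 -> (forall x, eta x != 0 -> w0 <= w x) ->
  (forall x, etag x != 0 -> w x <= m) ->
  (forall psi, C1 psi -> (forall x, 0 <= psi x) ->
    (forall x, eta x = 0 -> psi x = 0) ->
    (forall x, ~ E x -> grad psi x = 0) ->
    (\int[mu]_(x in E) (dotv (pflux p (wg x)) (grad psi x))%:E <=
     \int[mu]_(x in E) (psi x / w x)%:E)%E) ->
  {ae mu, forall x, E x -> 0 < eta x -> w x <= U x}.
Proof.
move=> p1 m0 [[mEU mU mEg ig] eqU appr] Hw Heta eta0 etaE etagE w00 etaw etagm sub.
have mE : measurable E := @measurable_obox R n.+1 a b.
have Eoo : (mu E < +oo)%E by exact: obox_fin.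
have [A EA] : exists A, E `<=` cube A.
  by have [A HA] := @cbox_cube R n.+1 a b; exists A; apply: subset_trans HA; exact: obox_cbox.
have [_ _ cwg] := Hw; have [_ _ cetag] := Heta.
have cw := hasgrad_continuous Hw; have ceta := hasgrad_continuous Heta.
have [Cg Cg0 HCg] := continuous_field_bounded A cwg.
have [Ce Ce0 HCe] := continuous_field_bounded A cetag.
have [Ch Ch0 HCh] := continuous_bounded_cube A ceta.
have mcts (f : V -> R) : continuous f -> measurable_fun E f.
  by move=> cf; apply: (@measurable_funS _ _ _ _ setT) => //; exact: continuous_measurable_rV.
have mEw := mcts _ cw; have mEeta := mcts _ ceta.
have mEwg : measurable_field E wg by exact: continuous_field.
pose Cb := 1 + Cg `^ (p - 1).
pose C := 2 * Ch * (w0^-1 + m^-1) + 2 * Ch * Cb + 2 * Cb * Ce.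
have w0i : 0 < w0^-1 by rewrite invr_gt0.
have m0i : 0 < m^-1 by rewrite invr_gt0.
have C0 : 0 <= C.
  by rewrite /C !addr_ge0// ?mulr_ge0// ?addr_ge0 ?powR_ge0// ltW.
pose F x := eta x * smoothstep (w x - U x) * ((U x)^-1 - (w x)^-1).
have mstep (f : V -> R) : measurable_fun E f -> measurable_fun E (fun x => smoothstep (f x)).
  move=> mf; apply: (@measurableT_comp _ _ _ _ _ _ smoothstep) => //.
  by apply: continuous_measurable_fun; exact: hasderiv_continuous hasderiv_smoothstep.
have minv (f : V -> R) : measurable_fun E f -> measurable_fun E (fun x => (f x)^-1).
  move=> mf; rewrite (_ : (fun x => _) = (fun x => 1 / f x)).
    exact: measurable_fun_div.
  by apply/funext => x; rewrite div1r.
have U0 x : 0 < U x by rewrite (lt_le_trans m0).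
have F0 x : 0 <= F x.
  rewrite /F; have [->|e0] := eqVneq (eta x) 0; first by rewrite !mul0r.
  have [wU|Uw] := leP (w x) (U x); first by rewrite smoothstep_le0 ?subr_le0// mulr0 mul0r.
  have /andP[s0 _] := smoothstep_itv (w x - U x).
  by rewrite mulr_ge0 ?mulr_ge0// subr_ge0 lef_pV2 ?posrE ?ltW// (lt_trans (U0 x)).
have invE x : eta x != 0 -> 0 <= (w x)^-1 <= w0^-1.
  move=> e0; have ww := etaw _ e0.
  by rewrite invr_ge0 (le_trans (ltW w00) ww)/= lef_pV2 ?posrE// (lt_le_trans w00).
have invU x : 0 <= (U x)^-1 <= m^-1.
  by rewrite invr_ge0 (ltW (U0 x))/= lef_pV2 ?posrE.
have mF : measurable_fun E F.
  apply: measurable_funM; last by apply: measurable_funB; exact: minv.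
  by apply: measurable_funM => //; apply: mstep; exact: measurable_funB.
have iF : mu.-integrable E (EFin \o F).
  apply: (@bounded_integrable _ _ _ _ (Ch * 1 * (w0^-1 + m^-1))) => // x Ex.
  rewrite /F; have [->|e0] := eqVneq (eta x) 0.
    by rewrite !mul0r normr0 !mulr_ge0// addr_ge0// ltW.
  have /andP[s0 s1] := smoothstep_itv (w x - U x).
  have /andP[i1 i2] := invE _ e0; have /andP[j1 j2] := invU x.
  rewrite !normrM; apply: ler_pM => //.
    by apply: ler_pM => //; [exact/HCh/EA|rewrite ger0_norm].
  by rewrite ler_norml; apply/andP; split; lra.
have iW := weight_integrable p1 mE Eoo mEg ig.
have key (e : R) : 0 < e -> (\int[mu]_(x in E) (F x)%:E <= C%:E * e%:E)%E.
  move=> e0; have [v Cv ve] := appr _ e0.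
  have Hv := C1_hasgrad Cv.
  have cv := hasgrad_continuous Hv; have [_ _ cvg'] := Hv.
  pose psi x := eta x * smoothstep (w x - v x).
  pose psig x := eta x *: (dsmoothstep (w x - v x) *: (wg x - grad v x)) + smoothstep (w x - v x) *: etag x.
  have Hpsi : hasgrad psi psig.
    apply: (hasgrad_ext (hasgradM Heta
      (hasgrad_comp (hasgradD Hw (hasgradZ (-1) Hv)) hasderiv_smoothstep))) => x;
      by rewrite ?mulN1r// ?scaleN1r.
  have Cpsi : C1 psi := hasgrad_C1 Hpsi.
  have [_ gpsi cpsig] := Hpsi.
  have cpsi := hasgrad_continuous Hpsi.
  have mEpsi := mcts _ cpsi.
  have psi0 x : 0 <= psi x.
    by have /andP[s0 _] := smoothstep_itv (w x - v x); rewrite mulr_ge0.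
  have psiE x : ~ E x -> psi x = 0 by move=> xE; rewrite /psi etaE// mul0r.
  have psigE x : ~ E x -> grad psi x = 0.
    by move=> xE; rewrite gpsi /psig etaE// etagE// scale0r scaler0 addr0.
  have I34 := eqU psi Cpsi psiE psigE.
  have I12 : (\int[mu]_(x in E) (dotv (pflux p (wg x)) (grad psi x))%:E <=
     \int[mu]_(x in E) (psi x / w x)%:E)%E.
    by apply: sub => // x e00; rewrite /psi e00 mul0r.
  have gradE : grad psi = psig by exact/funext.
  rewrite gradE in I34 I12.
  have mEpsig : measurable_field E psig by exact: continuous_field.
  have [Cp Cp0 HCp] := continuous_field_bounded A cpsig.
  have psiCh x : E x -> `|psi x| <= Ch.
    move=> Ex; have /andP[s0 s1] := smoothstep_itv (w x - v x).
    rewrite /psi normrM -[Ch]mulr1; apply: ler_pM => //; last by rewrite ger0_norm.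
    exact/HCh/EA.
  have i1 : mu.-integrable E (EFin \o (fun x => psi x / w x)).
    apply: (@bounded_integrable _ _ _ _ (Ch * w0^-1)) => //.
      exact: measurable_fun_div.
    move=> x Ex; have [ex0|e00] := eqVneq (eta x) 0.
      by rewrite /psi ex0 !mul0r normr0 mulr_ge0// ltW.
    have /andP[j1 j2] := invE _ e00.
    by rewrite normrM; apply: ler_pM => //; [exact: psiCh|rewrite ger0_norm].
  have i3 : mu.-integrable E (EFin \o (fun x => psi x / U x)).
    apply: (@bounded_integrable _ _ _ _ (Ch * m^-1)) => //.
      exact: measurable_fun_div.
    move=> x Ex; have /andP[j1 j2] := invU x.
    by rewrite normrM; apply: ler_pM => //; [exact: psiCh|rewrite ger0_norm].
  have i2 : mu.-integrable E (EFin \o (fun x => dotv (pflux p (wg x)) (psig x))).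
    apply: (@bounded_integrable _ _ _ _ (Cg `^ (p - 1) * Cp)) => //.
      exact: measurable_pflux.
    move=> x Ex; rewrite (le_trans (dotv_norm_le _ _))// enorm_pflux//.
    apply: ler_pM; rewrite ?powR_ge0 ?enorm_ge0//; last exact/HCp/EA.
    apply: ge0_ler_powR; rewrite ?nnegrE ?enorm_ge0 ?subr_ge0 ?(ltW p1)//.
    exact/HCg/EA.
  have i4 : mu.-integrable E (EFin \o (fun x => dotv (pflux p (g x)) (psig x))).
    have iWC := integrableZl mE Cp iW.
    apply: (le_integrable mE _ _ iWC).
      by apply/measurable_EFinP; exact: measurable_pflux.
    move=> x Ex /=; rewrite lee_fin (le_trans (dotv_norm_le _ _))// enorm_pflux//.
    have wge := weight_ge1 p g x.
    rewrite [leRHS]ger0_norm ?mulr_ge0// ?(le_trans _ wge)// mulrC.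
    apply: ler_pM; rewrite ?powR_ge0 ?enorm_ge0//; first exact/HCp/EA.
    by rewrite /weight lerDr.
  pose W x := weight p g x * (`|v x - U x| + \sum_i `|grad v x ord0 i - g x ord0 i|).
  have W0 x : 0 <= W x.
    by rewrite mulr_ge0 ?(le_trans _ (weight_ge1 _ _ _))// addr_ge0// sumr_ge0.
  have mEv : measurable_fun E v := mcts _ cv.
  have mW : measurable_fun E W.
    apply: measurable_funM; first exact: measurable_weight.
    apply: measurable_funD.
      by apply: measurableT_comp => //; exact: measurable_funB.
    apply: measurable_sum => i; apply: measurableT_comp => //.
    apply: measurable_funB => //; exact: (continuous_field (E := E) cvg').
  have iWW : mu.-integrable E (EFin \o W).
    apply/integrableP; split; first exact/measurable_EFinP.
    apply: le_lt_trans (_ : (e%:E < +oo)%E); last by rewrite ltry.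
    apply: le_trans (ltW ve); rewrite le_eqVlt; apply/orP; left; apply/eqP.
    by apply: eq_integral => x _ /=; rewrite ger0_norm.
  have iCW := integrableZl mE C iWW.
  have iT := integrableB mE (integrableB mE i1 i2) (integrableB mE i3 i4).
  have iTW := integrableB mE iCW iT.
  have le1 : (\int[mu]_(x in E) (F x)%:E <= \int[mu]_(x in E) ((C%:E * (W x)%:E) -
     ((((psi x / w x)%:E - (dotv (pflux p (wg x)) (psig x))%:E)) -
      ((psi x / U x)%:E - (dotv (pflux p (g x)) (psig x))%:E))))%E.
    apply: le_integral => // x; rewrite inE => Ex.
    rewrite -(EFinM C (W x)) -!EFinB lee_fin.
    have := @barrier_comparison_pointwise p m (w x) (U x) (v x) (eta x) w0 Ch Cg Ce (wg x) (g x)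
      (grad v x) (etag x) p1 m0 (mU x) w00 _ (etaw x) (etagm x) (HCg _ (EA _ Ex)) (HCe _ (EA _ Ex))
      (psig x) Cb erefl erefl.
    rewrite eta0 (le_trans (ler_norm _) (HCh _ (EA _ Ex))) => /(_ erefl).
    rewrite -/(psi x) -/C -/(weight p g x) -/(W x) => H.
    have -> : F x = - (eta x * smoothstep (w x - U x) * ((w x)^-1 - (U x)^-1)) by rewrite /F; ring.
    lra.
  apply: le_trans le1 _.
  rewrite (integralB mE iCW iT) integralZl//.
  rewrite (integralB mE (integrableB mE i1 i2) (integrableB mE i3 i4)).
  rewrite (integralB mE i1 i2) (integralB mE i3 i4).
  pose J1 := (\int[mu]_(x in E) (psi x / w x)%:E)%E.
  pose J2 := (\int[mu]_(x in E) (dotv (pflux p (wg x)) (psig x))%:E)%E.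
  pose J3 := (\int[mu]_(x in E) (psi x / U x)%:E)%E.
  pose J4 := (\int[mu]_(x in E) (dotv (pflux p (g x)) (psig x))%:E)%E.
  pose JW := (\int[mu]_(x in E) (W x)%:E)%E.
  have f1 : J1 \is a fin_num := integrable_fin_num mE i1.
  have f2 : J2 \is a fin_num := integrable_fin_num mE i2.
  have f3 : J3 \is a fin_num := integrable_fin_num mE i3.
  have f4 : J4 \is a fin_num := integrable_fin_num mE i4.
  have fW : JW \is a fin_num := integrable_fin_num mE iWW.
  change (C%:E * JW - (J1 - J2 - (J3 - J4)) <= C%:E * e%:E)%E.
  have H12 : (J2 <= J1)%E := I12.
  have H34 : J4 = J3 := I34.
  have HW : (JW < e%:E)%E := ve.
  rewrite H34 subee// sube0.
  rewrite -(fineK f1) -(fineK f2) lee_fin in H12.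
  rewrite -(fineK fW) lte_fin in HW.
  rewrite -(fineK f1) -(fineK f2) -(fineK fW) -(EFinB (fine J1)) -(EFinM C (fine JW)) -(EFinM C e) -(EFinB (C * fine JW)) lee_fin.
  have := ler_wpM2l C0 (ltW HW); lra.
have F_int : (\int[mu]_(x in E) `|(F x)%:E| = 0)%E.
  under eq_integral do rewrite abse_EFin ger0_norm//.
  have fF : (\int[mu]_(x in E) (F x)%:E)%E \is a fin_num := integrable_fin_num mE iF.
  apply/eqP; rewrite eq_le integral_ge0 ?andbT//; last by move=> x _; rewrite lee_fin.
  rewrite leNgt; apply/negP => H.
  move: key; rewrite -(fineK fF) in H *; set r := fine _ in H *.
  rewrite lte_fin in H => /(_ (r / (2 * (C + 1)))).
  have C1 : 0 < 2 * (C + 1) by lra.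
  rewrite divr_gt0// => /(_ erefl); rewrite -EFinM lee_fin mulrA ler_pdivlMr//; nra.
have mF' : measurable_fun E (EFin \o F) by exact/measurable_EFinP.
have /(ae_eq_integral_abs mu mE mF') := F_int.
apply: filterS => x H Ex ex; have [] := H Ex; rewrite /F => /eqP.
rewrite mulf_eq0 mulf_eq0 (gt_eqF ex)/=; case/orP => [/eqP s0|].
  rewrite leNgt; apply/negP => Uw.
  by have := @smoothstep_gt0 R (w x - U x); rewrite s0 subr_gt0 Uw ltxx => /(_ erefl).
by rewrite subr_eq0 => /eqP/invr_inj ->.
Qed.

End comparison.

(** * The divergence theorem for compactly supported fields *)

Section divergence.
Context {R : realType} {n : nat}.
Local Notation V := 'rV[R]_n.
Local Notation mu := (@lebesgue_rV R n).
Implicit Types (a b : 'I_n -> R).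

Lemma integral_divergence a b (F : V -> V) (dF : 'I_n -> V -> V) (psi : V -> R)
    (E := obox a b : set V) :
  (forall i, hasgrad (fun x => F x ord0 i) (dF i)) -> C1 psi ->
  (forall x, ~ E x -> psi x = 0) -> (forall x, ~ E x -> grad psi x = 0) ->
  (\int[mu]_(x in E) (dotv (F x) (grad psi x))%:E =
   \int[mu]_(x in E) (psi x * - \sum_i dF i x ord0 i)%:E)%E.
Proof.
move=> HF Cpsi psi0 gpsi0.
have Hpsi := C1_hasgrad Cpsi.
have mE : measurable E := @measurable_obox R n a b.
have [A EA] : exists A, E `<=` cube A.
  by have [A HA] := @cbox_cube R n a b; exists A; apply: subset_trans HA; exact: obox_cbox.
pose G i x := (F x ord0 i *: grad psi x + psi x *: dF i x) ord0 i.
have HG i := hasgradM (HF i) Hpsi.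
have cG i : continuous (G i) by exact: hasgrad_coordc (HG i).
have GE i x : G i x = F x ord0 i * grad psi x ord0 i + psi x * dF i x ord0 i.
  by rewrite /G !mxE.
have G0 i x : ~ E x -> G i x = 0.
  by move=> xE; rewrite GE psi0// gpsi0// mxE mulr0 mul0r addr0.
have iG i : mu.-integrable E (EFin \o G i).
  apply: (@integrableS _ _ _ mu setT) => //.
  by apply: (continuous_integrable (A := A)) => // x xA; apply: G0 => /EA.
have int0 i : (\int[mu]_(x in E) (G i x)%:E = 0)%E.
  rewrite -(@integral_restrict _ _ setT)//; last by move=> x _ /(G0 i) ->.
  apply: (@integral_partial_eq0 R n (fun x => F x ord0 i * psi x) (G i) i A).
  - by move=> x; exact: hasgrad_is_derive (HG i).
  - exact: cG.
  - by move=> x xA; rewrite psi0 ?mulr0// => /EA.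
  - by move=> x xA; apply: G0 => /EA.
have cpsi := hasgrad_continuous Hpsi.
have cdF i : continuous (fun x => dF i x ord0 i) by exact: hasgrad_coordc (HF i).
pose D x := psi x * - \sum_i dF i x ord0 i.
have cD : continuous D.
  apply: continuous_funM => //.
  rewrite (_ : (fun x => - _) = (fun x => -1 * \sum_i dF i x ord0 i)).
    by apply: continuous_funM; [exact: cst_continuous|exact: continuous_fun_sum].
  by apply/funext => x; rewrite mulN1r.
have iD : mu.-integrable E (EFin \o D).
  apply: (@integrableS _ _ _ mu setT) => //.
  apply: (continuous_integrable (A := A)) => // x xA.
  by rewrite /D psi0 ?mul0r// => /EA.
have -> : (\int[mu]_(x in E) (dotv (F x) (grad psi x))%:E =
   \int[mu]_(x in E) ((\sum_i (G i x)%:E) + (D x)%:E))%E.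
  apply: eq_integral => x _; rewrite sumEFin -EFinD; congr (_%:E).
  rewrite /D mulrN mulr_sumr -sumrN -big_split/=; apply: eq_bigr => i _.
  by rewrite GE addrK.
rewrite integralD//; last by apply: integrable_sum => // i _; exact: iG.
rewrite integral_sum//.
by rewrite big1 => [|i _]; [rewrite add0e|exact: int0].
Qed.

End divergence.

(** * Real powers of a positive function *)

Section softshift.
Context {R : realType}.
Implicit Types (q t tau : R).

Lemma hasderiv_pow m : hasderiv (fun t : R => t ^+ m.+1) (fun t => m.+1%:R * t ^+ m).
Proof.
elim: m => [|m IH].
  apply: hasderiv_eq hasderiv_id _ _ => t /=; first by rewrite expr1.
  by rewrite expr0 mulr1.
apply: hasderiv_eq (hasderivM hasderiv_id IH) _ _ => t /=; first by rewrite -exprS.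
by rewrite mulr1 mulrCA -exprS -[m.+2]addn1 natrD mulrDl mul1r.
Qed.

Lemma hasderiv_powR_comp (f df : R -> R) q : hasderiv f df -> (forall t, 0 < f t) ->
  hasderiv (fun t => f t `^ q) (fun t => q * f t `^ (q - 1) * df t).
Proof.
move=> Cf f0; have cf := hasderiv_continuous Cf; case: Cf => f1 f2.
split=> t.
  have [df1 <-] := f1 t.
  have [dp dpE] := @is_derive1_powR R q (f t) (f0 t).
  split.
    apply/derivable1_diffP; apply: (@differentiable_comp _ _ _ _ f (fun s : R => s `^ q));
      exact/derivable1_diffP.
  by rewrite -dpE -!derive1E -(@derive1_comp _ f (fun s : R => s `^ q)).
have cp : continuous (fun t => f t `^ (q - 1)).
  move=> s; apply: (@continuous_comp _ _ _ f (fun u : R => u `^ (q - 1))); first exact: cf.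
  have [dp _] := @is_derive1_powR R (q - 1) (f s) (f0 s).
  by apply: differentiable_continuous; exact/derivable1_diffP.
have : continuous (fun t => q * f t `^ (q - 1) * df t).
  by apply: continuous_funM => //; apply: continuous_funM => //; exact: cst_continuous.
exact.
Qed.

(** It agrees with t + tau for t >= 0 and stays above tau / 2 everywhere, which keeps
    its real powers of class C1 on the whole line. *)
Definition softshift tau t := tau / 2 + (2 * tau)^-1 * (pospow 2 (t + tau) - pospow 2 t).
Definition dsoftshift tau t := tau^-1 * (pospart (t + tau) - pospart t).

Lemma hasderiv_softshift tau : tau != 0 -> hasderiv (softshift tau) (dsoftshift tau).
Proof.
move=> tau0.
have P2 : hasderiv (pospow 2) (fun t : R => 2 * pospow (2 - 1) t) by apply: hasderiv_pospow; lra.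
have Q2 := hasderiv_comp (hasderivD hasderiv_id (hasderiv_cst tau)) P2.
have := hasderivD (hasderiv_cst (tau / 2)) (hasderivM (hasderiv_cst ((2 * tau)^-1))
  (hasderivD Q2 (hasderivM (hasderiv_cst (-1)) P2))).
move=> /hasderiv_eq; apply => t /=; first by rewrite /softshift mulN1r.
by rewrite /dsoftshift !pospow1E; field.
Qed.

Lemma softshift_ge tau t : 0 < tau -> tau / 2 <= softshift tau t.
Proof.
move=> tau0; rewrite /softshift lerDl mulr_ge0 ?invr_ge0 ?mulr_ge0 ?(ltW tau0)//.
rewrite subr_ge0 !pospow2E.
have [t0|/ltW t0] := leP t 0; first by rewrite (pospart_neg t0) expr0n/= sqr_ge0.
by rewrite !pospart_pos ?addr_ge0 ?(ltW tau0)//; nra.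
Qed.

Lemma softshift_gt0 tau t : 0 < tau -> 0 < softshift tau t.
Proof. by move=> tau0; apply: lt_le_trans (softshift_ge t tau0); rewrite divr_gt0. Qed.

Lemma softshift_pos tau t : 0 < tau -> 0 <= t -> softshift tau t = t + tau.
Proof.
move=> tau0 t0; rewrite /softshift !pospow2E !pospart_pos ?addr_ge0 ?(ltW tau0)//.
by field; rewrite gt_eqF.
Qed.

Lemma dsoftshift_pos tau t : 0 < tau -> 0 <= t -> dsoftshift tau t = 1.
Proof.
move=> tau0 t0; rewrite /dsoftshift !pospart_pos ?addr_ge0 ?(ltW tau0)//.
by field; rewrite gt_eqF.
Qed.

End softshift.

(** * Radial subsolutions on balls *)

Section barrier.
Context {R : realType} {n : nat}.
Local Notation V := 'rV[R]_n.
Local Notation mu := (@lebesgue_rV R n).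
Context (p th tau k M : R) (m : nat) (c : V).

Definition rescale (x : V) : V := M^-1 *: (x - c).
Definition rescale_sq (x : V) : R := dotv (rescale x) (rescale x).
(** Positive exactly in the ball of radius M about c. A large m makes the flux of the
    barrier of class C1 at the centre, for every p > 1. *)
Definition depth (x : V) : R := 1 - rescale_sq x ^+ m.+1.
Definition ddepth (x : V) : V := - (2 * m.+1%:R / M * rescale_sq x ^+ m) *: rescale x.

Lemma hasgrad_rescale i : hasgrad (fun x => rescale x ord0 i) (fun=> M^-1 *: delta_mx ord0 i).
Proof.
apply: hasgrad_ext (hasgradZ M^-1 (hasgradD (hasgrad_coord i) (hasgrad_cst (- c ord0 i)))) _ _ => x.
  by rewrite !mxE.
by rewrite addr0.
Qed.

Lemma hasgrad_rescale_sq : hasgrad rescale_sq (fun x => (2 / M) *: rescale x).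
Proof.
have := hasgrad_sum (index_enum 'I_n) (fun i => hasgradM (hasgrad_rescale i) (hasgrad_rescale i)).
move=> /hasgrad_ext; apply => x //.
apply/rowP => j; rewrite summxE (bigD1 j)//= big1 ?addr0; last first.
  by move=> i ij; rewrite !mxE eqxx/= eq_sym (negbTE ij) !mulr0 addr0.
by rewrite !mxE !eqxx/=; ring.
Qed.

Lemma hasgrad_depth : hasgrad depth ddepth.
Proof.
have := hasgradD (hasgrad_cst 1) (hasgradZ (-1) (hasgrad_comp hasgrad_rescale_sq (hasderiv_pow m))).
move=> /hasgrad_ext; apply => x; first by rewrite mulN1r.
by rewrite add0r scalerA scalerA; congr (_ *: _); ring.
Qed.

(** The function w(c + M y) / M of y does not depend on M, and neither does the
    inequality -div (pflux p Dw) <= 1/w, which has this scaling invariance. *)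
Definition barrier (x : V) : R :=
  k * M * (softshift tau (depth x) `^ (1 - th) - tau `^ (1 - th)).

Definition dbarrier (x : V) : V :=
  (k * M * ((1 - th) * softshift tau (depth x) `^ (- th) * dsoftshift tau (depth x))) *: ddepth x.

Hypothesis (p1 : 1 < p) (th0 : 0 < th) (thp : th * p <= 1) (tau0 : 0 < tau) (tau1 : tau <= 1)
  (thtau : th * tau `^ (- (th * p)) <= 1) (M0 : 0 < M) (k0 : 0 < k).

Let K := 2 * m.+1%:R * k * (1 - th).
Let e := (m%:R + 2^-1) * (p - 1) - 2^-1.

Hypothesis (e1 : 1 < e)
  (kC : k * (2 * m.+1%:R * k) `^ (p - 1) * (2 * (n%:R + 2 * e) + 2 * m.+1%:R * (p - 1)) <= 1).

Let th1 : th < 1.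
Proof. by rewrite (lt_le_trans _ thp)// ltr_pMr. Qed.

Let K0 : 0 < K.
Proof. by rewrite /K !mulr_gt0// subr_gt0. Qed.

Lemma hasgrad_barrier : hasgrad barrier dbarrier.
Proof.
have H1 := hasderiv_powR_comp (1 - th) (hasderiv_softshift (lt0r_neq0 tau0)) (fun t => softshift_gt0 t tau0).
have H2 := hasderivM (hasderiv_cst (k * M)) (hasderivD H1 (hasderiv_cst (- tau `^ (1 - th)))).
have := hasgrad_comp hasgrad_depth H2.
move=> /hasgrad_ext; apply => x //.
rewrite /dbarrier; congr (_ *: _); rewrite addr0 mulr0 addr0.
by rewrite (_ : 1 - th - 1 = - th); last by ring.
Qed.

Lemma rescale_sq_ge0 x : 0 <= rescale_sq x. Proof. exact: dotvv_ge0. Qed.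

Lemma depth_rescale_sq x : 0 <= depth x -> rescale_sq x <= 1.
Proof.
rewrite /depth subr_ge0 => h; rewrite leNgt; apply/negP => r1.
by move: h; rewrite leNgt exprn_egt1.
Qed.

(** The closed form of the flux of the barrier inside the ball, extended to a field of
    class C1 on the whole space. *)
Definition barrier_flux (x : V) : V :=
  - (K `^ (p - 1) * (softshift tau (depth x) `^ (- (th * (p - 1))) * pospow e (rescale_sq x))) *: rescale x.

(** Here |Dw| = a |y| with a = K sigma^(-th) |y|^(2m), and e is the exponent with
    (a |y|)^(p-2) a = K^(p-1) sigma^(-th(p-1)) (|y|^2)^e. *)
Lemma pflux_barrier x : 0 <= depth x -> pflux p (dbarrier x) = barrier_flux x.
Proof.
move=> s0; have p10 : 0 < p - 1 by rewrite subr_gt0.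
have sig0 := softshift_gt0 (depth x) tau0.
set a := K * softshift tau (depth x) `^ (- th) * rescale_sq x ^+ m.
have r0 := rescale_sq_ge0 x.
have a0 : 0 <= a.
  apply: mulr_ge0; last exact: exprn_ge0.
  by apply: mulr_ge0; [exact: ltW|exact: powR_ge0].
have -> : dbarrier x = (- a) *: rescale x.
  rewrite /dbarrier /ddepth dsoftshift_pos// scalerA; congr (_ *: _).
  by rewrite /a /K; field; rewrite gt_eqF.
rewrite /pflux enormZ normrN ger0_norm// scalerA /barrier_flux.
have [d0|d0] := eqVneq (rescale x) 0; first by rewrite d0 !scaler0.
have r1 : 0 < rescale_sq x.
  rewrite lt0r r0 andbT /rescale_sq -enorm_sqr expf_eq0/=.
  by apply: contraNN d0 => /eqP/enorm_eq0 ->.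
congr (_ *: _); rewrite mulrN; congr (- _).
have en : enorm (rescale x) = rescale_sq x `^ 2^-1 by rewrite powR12_sqrt.
rewrite en pospow_pos//.
have a1 : 0 < a.
  apply: mulr_gt0; last exact: exprn_gt0.
  by apply: mulr_gt0; last exact: powR_gt0.
rewrite powRM ?powR_ge0// -powRrM.
have -> : a `^ (p - 2) * rescale_sq x `^ (2^-1 * (p - 2)) * a =
   a `^ (p - 1) * rescale_sq x `^ (2^-1 * (p - 2)).
  rewrite mulrAC; congr (_ * _).
  rewrite -[X in _ * X = _](powRr1 a0) -powRD; last by rewrite (gt_eqF a1) implybT.
  by congr (powR _ _); ring.
have Kk : 0 <= K * softshift tau (depth x) `^ (- th) by apply: mulr_ge0; [exact: ltW|exact: powR_ge0].
rewrite /a -powR_mulrn// (powRM _ Kk (powR_ge0 _ _)).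
rewrite powRM ?powR_ge0 ?(ltW K0)// -!powRrM -!mulrA; congr (_ * _).
congr (_ `^ _ * _); first by ring.
rewrite -powRD; last by rewrite (gt_eqF r1) implybT.
congr (powR _ _).
by rewrite /e; field.
Qed.

Definition flux_factor (x : V) : R := softshift tau (depth x) `^ (- (th * (p - 1))) * pospow e (rescale_sq x).

Definition dflux_factor (x : V) : V :=
  softshift tau (depth x) `^ (- (th * (p - 1))) *: ((e * pospow (e - 1) (rescale_sq x)) *: ((2 / M) *: rescale x)) +
  pospow e (rescale_sq x) *: ((- (th * (p - 1)) * softshift tau (depth x) `^ (- (th * (p - 1)) - 1) *
     dsoftshift tau (depth x)) *: ddepth x).

Lemma hasgrad_flux_factor : hasgrad flux_factor dflux_factor.
Proof.
have H1 := hasderiv_powR_comp (- (th * (p - 1))) (hasderiv_softshift (lt0r_neq0 tau0)) (fun t => softshift_gt0 t tau0).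
exact: hasgradM (hasgrad_comp hasgrad_depth H1) (hasgrad_comp hasgrad_rescale_sq (hasderiv_pospow e1)).
Qed.

Definition dbarrier_flux (i : 'I_n) (x : V) : V :=
  - K `^ (p - 1) *: (flux_factor x *: (M^-1 *: delta_mx ord0 i) + rescale x ord0 i *: dflux_factor x).

Lemma hasgrad_barrier_flux i : hasgrad (fun x => barrier_flux x ord0 i) (dbarrier_flux i).
Proof.
have := hasgradZ (- K `^ (p - 1)) (hasgradM hasgrad_flux_factor (hasgrad_rescale i)).
move=> /hasgrad_ext; apply => x //.
by rewrite /barrier_flux [RHS]mxE /flux_factor; ring.
Qed.

Lemma div_barrier_flux x : 0 <= depth x -> - \sum_i dbarrier_flux i x ord0 i =
  K `^ (p - 1) / M * ((n%:R + 2 * e) * ((depth x + tau) `^ (- (th * (p - 1))) * rescale_sq x `^ e) +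
     2 * m.+1%:R * (th * (p - 1) * (depth x + tau) `^ (- (th * (p - 1)) - 1)) *
      (rescale_sq x ^+ m.+1 * rescale_sq x `^ e)).
Proof.
move=> s0; have r0 := rescale_sq_ge0 x.
have -> : \sum_i dbarrier_flux i x ord0 i =
   - K `^ (p - 1) * (n%:R * (flux_factor x / M) + dotv (rescale x) (dflux_factor x)).
  have -> : n%:R * (flux_factor x / M) = \sum_(i < n) flux_factor x / M.
    by rewrite sumr_const card_ord mulr_natl.
  rewrite -big_split/= mulr_sumr; apply: eq_bigr => i _.
  rewrite /dbarrier_flux mxE; congr (_ * _); rewrite mxE; congr (_ + _).
    by rewrite !mxE !eqxx mulr1.
  by rewrite mxE.
have yy : dotv (rescale x) (rescale x) = rescale_sq x by [].
rewrite /dflux_factor /ddepth; move: (rescale x) yy => y yy.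
rewrite dotvDr !dotvZr yy /flux_factor softshift_pos// dsoftshift_pos//.
rewrite pospow_pos// pospow_pos// exprS.
have e0 : 0 < e by rewrite (lt_trans _ e1).
rewrite -(mulr_powRB1 r0 e0).
field. by rewrite gt_eqF.
Qed.

Lemma barrier_gt0 x : 0 < depth x -> 0 < barrier x.
Proof.
move=> s0; rewrite /barrier (softshift_pos tau0 (ltW s0)) !mulr_gt0// subr_gt0.
have sp : 0 <= depth x + tau := addr_ge0 (ltW s0) (ltW tau0).
apply: gt0_ltr_powR; rewrite ?subr_gt0 ?th1 ?nnegrE ?(ltW tau0)//.
by rewrite ltrDr.
Qed.

(** Multiplying the divergence by w <= k M sigma^(1-th), where
    sigma = depth + tau lies between tau and 2, leaves the two powers
    sigma^(1 - th p) <= 2 and th sigma^(-th p) <= th tau^(-th p) <= 1. All that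
    remains is bounded by the constant in kC. *)
Lemma barrier_subsolution x : 0 < depth x ->
  0 <= - \sum_i dbarrier_flux i x ord0 i <= (barrier x)^-1.
Proof.
move=> s0; rewrite (div_barrier_flux (ltW s0)).
have p10 : 0 < p - 1 by rewrite subr_gt0.
have r0 := rescale_sq_ge0 x; have r1 : rescale_sq x <= 1 by apply: depth_rescale_sq; rewrite ltW.
have e0 : 0 < e by rewrite (lt_trans _ e1).
set sig := depth x + tau.
have sig_tau : tau <= sig by rewrite lerDr ltW.
have sig0 : 0 < sig by rewrite (lt_le_trans tau0).
have sig2 : sig <= 2.
  by rewrite -[2]/(1 + 1) lerD// /depth gerBl exprn_ge0.
have re0 : 0 <= rescale_sq x `^ e by exact: powR_ge0.
have re1 : rescale_sq x `^ e <= 1.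
  rewrite -[leRHS](_ : 1 `^ e = 1); last by rewrite powR1.
  by apply: ge0_ler_powR; rewrite ?nnegrE ?(ltW e0).
have rm1 : rescale_sq x ^+ m.+1 * rescale_sq x `^ e <= 1.
  by rewrite mulr_ile1 ?exprn_ge0// exprn_ile1.
have rm0 : 0 <= rescale_sq x ^+ m.+1 * rescale_sq x `^ e by rewrite mulr_ge0 ?exprn_ge0.
set A := sig `^ (- (th * (p - 1))); set B := sig `^ _.
have A0 : 0 <= A by exact: powR_ge0.
have B0 : 0 <= B by exact: powR_ge0.
set Kp := K `^ (p - 1); have Kp0 : 0 <= Kp by exact: powR_ge0.
have tp0 : 0 <= th * (p - 1) by rewrite mulr_ge0 ?ltW.
have ne0 : 0 <= n%:R + 2 * e by rewrite addr_ge0 ?mulr_ge0 ?(ltW e0).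
set T1 := (n%:R + 2 * e) * _; set T2 := _ * (_ * _ * B) * _.
have T10 : 0 <= T1 by rewrite mulr_ge0// mulr_ge0.
have T20 : 0 <= T2 by rewrite !mulr_ge0 ?exprn_ge0 ?(ltW th0) ?(ltW p10).
have KM0 : 0 <= Kp / M by rewrite divr_ge0// ltW.
rewrite mulr_ge0 ?addr_ge0//=.
have b0 := barrier_gt0 s0.
rewrite -[leRHS]mul1r ler_pdivlMr//.
have bU : barrier x <= k * M * sig `^ (1 - th).
  rewrite /barrier (softshift_pos tau0 (ltW s0)); apply: ler_wpM2l; first by rewrite mulr_ge0 ?ltW.
  by rewrite gerBl powR_ge0.
apply: (@le_trans _ _ (Kp / M * (T1 + T2) * (k * M * sig `^ (1 - th)))).
  by apply: ler_wpM2l => //; rewrite mulr_ge0 ?addr_ge0.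
set S := sig `^ (1 - th); have S0 : 0 <= S by exact: powR_ge0.
have AS : A * S <= 2.
  rewrite /A /S -powRD ?(gt_eqF sig0) ?implybT//.
  rewrite (_ : - (th * (p - 1)) + (1 - th) = 1 - th * p); last by ring.
  have thp0 : 0 <= th * p by rewrite mulr_ge0 ?(ltW th0)// ltW// (lt_trans _ p1).
  apply: (@le_trans _ _ (2 `^ (1 - th * p))).
    by apply: ge0_ler_powR; rewrite ?nnegrE ?(ltW sig0)// subr_ge0.
  by rewrite -[leRHS]powRr1//; apply: ler_powR; [lra|rewrite gerBl].
have BS : th * (B * S) <= 1.
  apply: le_trans thtau; apply: ler_wpM2l; first exact: ltW.
  rewrite /B /S -powRD ?(gt_eqF sig0) ?implybT//.
  rewrite (_ : - (th * (p - 1)) - 1 + (1 - th) = - (th * p)); last by ring.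
  rewrite !powRN lef_pV2 ?posrE ?powR_gt0//.
  by apply: ge0_ler_powR; rewrite ?nnegrE ?(ltW sig0) ?(ltW tau0)// mulr_ge0 ?(ltW th0)// ltW// (lt_trans _ p1).
have T1S : T1 * S <= 2 * (n%:R + 2 * e).
  rewrite (_ : T1 * S = (n%:R + 2 * e) * (A * S * rescale_sq x `^ e)); last by rewrite /T1; ring.
  rewrite mulrC; apply: ler_wpM2r => //.
  by rewrite -[2]mulr1; apply: ler_pM => //; exact: mulr_ge0.
have T2S : T2 * S <= 2 * m.+1%:R * (p - 1).
  rewrite (_ : T2 * S = 2 * m.+1%:R * (p - 1) *
    (th * (B * S) * (rescale_sq x ^+ m.+1 * rescale_sq x `^ e))); last by rewrite /T2; ring.
  rewrite ger_pMr ?mulr_gt0//; apply: mulr_ile1 => //.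
  by apply: mulr_ge0; [exact: ltW|exact: mulr_ge0].
have KpE : Kp <= (2 * m.+1%:R * k) `^ (p - 1).
  apply: ge0_ler_powR; rewrite ?nnegrE ?(ltW p10) ?(ltW K0)//.
    by rewrite !mulr_ge0// ltW.
  by rewrite /K ger_pMr ?mulr_gt0// gerBl ltW.
apply: le_trans kC.
have -> : Kp / M * (T1 + T2) * (k * M * S) = k * Kp * (T1 * S + T2 * S).
  by field; rewrite gt_eqF.
apply: ler_pM => //.
- by apply: mulr_ge0 => //; exact: ltW.
- by rewrite addr_ge0// mulr_ge0.
- by apply: ler_wpM2l => //; exact: ltW.
- exact: lerD.
Qed.

(** The test function vanishes where the depth is at most s0, so only points where
    the barrier has its closed form flux contribute. *)
Lemma barrier_weak a b (psi : V -> R) (s0 : R) (E := obox a b : set V) :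
  0 < s0 -> C1 psi -> (forall x, 0 <= psi x) ->
  (forall x, depth x <= s0 -> psi x = 0) ->
  (forall x, ~ E x -> psi x = 0) -> (forall x, ~ E x -> grad psi x = 0) ->
  (\int[mu]_(x in E) (dotv (pflux p (dbarrier x)) (grad psi x))%:E <=
   \int[mu]_(x in E) (psi x / barrier x)%:E)%E.
Proof.
move=> s00 Cpsi psi0 psis psiE gpsiE.
have mE : measurable E := @measurable_obox R n a b.
have mcts (f : V -> R) : continuous f -> measurable_fun E f.
  by move=> cf; apply: (@measurable_funS _ _ _ _ setT) => //; exact: continuous_measurable_rV.
have cpsi := hasgrad_continuous (C1_hasgrad Cpsi).
have -> : (\int[mu]_(x in E) (dotv (pflux p (dbarrier x)) (grad psi x))%:E =
  \int[mu]_(x in E) (dotv (barrier_flux x) (grad psi x))%:E)%E.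
  apply: eq_integral => x _; congr (_%:E).
  have [xs|xs] := ltP (depth x) s0.
    have -> : grad psi x = 0; last by rewrite !dotv0.
    apply: near0_grad.
    have : depth y @[y --> (x : V)] --> depth x by exact: (hasgrad_continuous hasgrad_depth).
    by move=> /cvgr_lt/(_ _ xs); apply: filterS => y ys; apply: psis; exact: ltW.
  by rewrite pflux_barrier// (le_trans (ltW s00)).
rewrite (integral_divergence hasgrad_barrier_flux Cpsi psiE gpsiE).
have pw x : 0 <= psi x * - \sum_i dbarrier_flux i x ord0 i <= psi x / barrier x.
  have [xs|xs] := leP (depth x) s0; first by rewrite psis// !mul0r lexx.
  have /andP[h1 h2] := barrier_subsolution (lt_trans s00 xs).
  by rewrite mulr_ge0//=; apply: ler_wpM2l.
apply: ge0_le_integral => //.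
- by move=> x _; rewrite lee_fin; have /andP[] := pw x.
- apply/measurable_EFinP; apply: measurable_funM; first exact: mcts.
  apply: measurableT_comp => //; apply: mcts; apply: continuous_fun_sum => i.
  exact: hasgrad_coordc (hasgrad_barrier_flux i).
- apply/measurable_EFinP; apply: measurable_fun_div; apply: mcts => //.
  exact: hasgrad_continuous hasgrad_barrier.
- by move=> x _; rewrite lee_fin; have /andP[] := pw x.
Qed.

End barrier.

(** * Weak solutions lie above the barriers *)

Section lower_bound.
Context {R : realType}.

(** On a box around the ball, u >= mu0 > 0. The level s0 is so small that the barrier
    is below mu0 where the depth is at most 2 s0: there nothing has to be proved,
    and there the cutoff may vary. *)
Lemma barrier_le_solution n (p th tau k M : R) (m : nat) (c : 'rV[R]_n.+1)
    (a b : 'I_n.+1 -> R) (u : 'rV[R]_n.+1 -> R)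
    (e := (m%:R + 2^-1) * (p - 1) - 2^-1) :
  1 < p -> 0 < th -> th * p <= 1 -> 0 < tau -> tau <= 1 ->
  th * tau `^ (- (th * p)) <= 1 -> 0 < M -> 0 < k -> 1 < e ->
  k * (2 * m.+1%:R * k) `^ (p - 1) *
    (2 * (n.+1%:R + 2 * e) + 2 * m.+1%:R * (p - 1)) <= 1 ->
  weak_solution p u -> cbox a b `<=` halfspace ->
  (forall x, 0 < depth M m c x -> obox a b x) ->
  {ae (@lebesgue_rV R n.+1), forall x, 0 < depth M m c x ->
     barrier th tau k M m c x <= u x}.
Proof.
move=> p1 th0 thp tau0 tau1 thtau M0 k0 e1 kC wu abH profE.
have [mu0 [U [g [m0 Uu reg]]]] := normalize_solution p1 wu abH.
have mU : forall x, mu0 <= U x by have [[]] := reg.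
have th1 : th < 1 by rewrite (lt_le_trans _ thp)// ltr_pMr.
pose G t := k * M * (softshift tau t `^ (1 - th) - tau `^ (1 - th)).
have CG : hasderiv G _ := hasderivM (hasderiv_cst (k * M)) (hasderivD
  (hasderiv_powR_comp (1 - th) (hasderiv_softshift (lt0r_neq0 tau0)) (fun t => softshift_gt0 t tau0))
  (hasderiv_cst (- tau `^ (1 - th)))).
have G0 : G 0 = 0 by rewrite /G softshift_pos// add0r subrr mulr0.
have Gmono (t1 t2 : R) : 0 <= t1 -> t1 <= t2 -> G t1 <= G t2.
  move=> t10 t12; have t20 := le_trans t10 t12.
  have h : (t1 + tau) `^ (1 - th) <= (t2 + tau) `^ (1 - th).
    have h1 := addr_ge0 t10 (ltW tau0); have h2 := addr_ge0 t20 (ltW tau0).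
    by apply: ge0_ler_powR; rewrite ?nnegrE ?lerD2r ?subr_ge0 ?(ltW th1).
  have kM := mulr_ge0 (ltW k0) (ltW M0).
  rewrite /G (softshift_pos tau0 t10) (softshift_pos tau0 t20).
  by apply: ler_wpM2l => //; rewrite lerD2r.
have [s0 s00 Gs0] : exists2 s0 : R, 0 < s0 & G (2 * s0) <= mu0.
  have : G t @[t --> (0 : R)] --> G 0 by exact: (hasderiv_continuous CG).
  rewrite G0 => /cvgr_lt/(_ _ m0)/nbhs_ballP[d /= d0 Hd].
  exists (d / 4); first by rewrite divr_gt0.
  apply/ltW/Hd; rewrite -ball_normE /= sub0r normrN ger0_norm; lra.
pose eta x := smoothstep (s0^-1 * (depth M m c x + - s0)).
pose etag x := dsmoothstep (s0^-1 * (depth M m c x + - s0)) *: (s0^-1 *: (ddepth M m c x + 0)).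
have Heta : hasgrad eta etag := hasgrad_comp
  (hasgradZ s0^-1 (hasgradD (hasgrad_depth M m c) (hasgrad_cst (- s0)))) hasderiv_smoothstep.
have small x : depth M m c x <= s0 -> s0^-1 * (depth M m c x + - s0) <= 0.
  by move=> h; rewrite mulr_ge0_le0 ?invr_ge0 ?(ltW s00)// subr_le0.
have large x : 2 * s0 <= depth M m c x -> 1 <= s0^-1 * (depth M m c x + - s0).
  by move=> h; rewrite mulrC ler_pdivlMr// mul1r lerBrDr -mulr2n -mulr_natl.
have etas x : depth M m c x <= s0 -> eta x = 0 by move=> /small h; rewrite /eta smoothstep_le0.
have etags x : depth M m c x <= s0 -> etag x = 0.
  by move=> /small h; rewrite /etag dsmoothstep_le0// scale0r.
have offE x : ~ obox a b x -> depth M m c x <= s0.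
  by move=> xE; rewrite leNgt; apply/negP => h; apply: xE; apply: profE; exact: lt_trans h.
have dich x : depth M m c x <= s0 \/ s0 < depth M m c x.
  by have [h|h] := leP (depth M m c x) s0; [left|right].
have bG x : barrier th tau k M m c x = G (depth M m c x) by [].
have eta_pos x : eta x != 0 -> s0 < depth M m c x.
  by move=> h; rewrite ltNge; apply/negP => /etas /eqP; rewrite (negbTE h).
have Gs : 0 < G s0.
  rewrite /G (softshift_pos tau0 (ltW s00)); apply: mulr_gt0; first exact: mulr_gt0.
  have h := addr_ge0 (ltW s00) (ltW tau0).
  by rewrite subr_gt0; apply: gt0_ltr_powR; rewrite ?nnegrE ?subr_gt0 ?(ltW tau0) ?ltrDr.
clearbody G.
have cmp : {ae (@lebesgue_rV R n.+1), forall x, obox a b x -> 0 < eta x ->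
    barrier th tau k M m c x <= U x}.
  apply: (barrier_comparison p1 m0 reg (hasgrad_barrier th k M m c tau0) Heta _ _ _ Gs).
  - by move=> x; have /andP[] := smoothstep_itv (s0^-1 * (depth M m c x + - s0)).
  - by move=> x /offE/etas.
  - by move=> x /offE/etags.
  - by move=> x /eta_pos h; rewrite bG; apply: Gmono; exact: ltW.
  - move=> x ex; rewrite bG; apply: le_trans Gs0.
    have [h|h] := dich x; first by have /eqP[] := ex; exact: etags.
    apply: Gmono; first by rewrite (le_trans (ltW s00))// ltW.
    rewrite leNgt; apply/negP => /ltW/large h2.
    by move: ex; rewrite /etag (dsmoothstep_ge1 h2) scale0r eqxx.
  - move=> psi Cpsi psi0 psie gpsiE.
    have psis x : depth M m c x <= s0 -> psi x = 0 by move=> /etas/psie.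
    apply: (barrier_weak p1 th0 thp tau0 tau1 thtau M0 k0 e1 kC s00) => //.
    by move=> x /offE/psis.
move: cmp Uu; apply: filterS2 => x cx Ux x0.
have Ex := profE _ x0; rewrite -(Ux Ex).
have [h|h] := dich x.
  apply: le_trans (mU x); apply: le_trans Gs0; rewrite bG.
  apply: Gmono; first exact: ltW.
  by rewrite (le_trans h)// mulr_natl mulr2n lerDl ltW.
by apply: cx => //; apply: smoothstep_gt0; rewrite mulr_gt0 ?invr_gt0// subr_gt0.
Qed.

End lower_bound.

(** * Choice of the parameters and conclusion *)

Section parameters.
Context {R : realType}.

(** Taking m > 2 / (p - 1) makes e exceed 1; the left-hand side of the last
    inequality is a constant times k^p. *)
Lemma exists_exponent_scale (N : nat) (p : R) : 1 < p ->
  exists m : nat, exists2 k : R, 0 < k &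
    let e := (m%:R + 2^-1) * (p - 1) - 2^-1 in 1 < e /\
    k * (2 * m.+1%:R * k) `^ (p - 1) *
    (2 * (N%:R + 2 * e) + 2 * m.+1%:R * (p - 1)) <= 1.
Proof.
move=> p1; have p10 : 0 < p - 1 by rewrite subr_gt0.
pose m := (Num.truncn (2 / (p - 1))).+1; exists m.
set e := (m%:R + 2^-1) * (p - 1) - 2^-1.
have m2 : 2 < m%:R * (p - 1) by rewrite -ltr_pdivrMr// /m truncnS_gt.
have e1 : 1 < e by rewrite /e; nra.
set X := 2 * m.+1%:R; set Y := 2 * (N%:R + 2 * e) + X * (p - 1).
have X0 : 0 < X by rewrite mulr_gt0.
have Y0 : 0 < Y.
  by rewrite ltr_pwDr ?mulr_gt0// mulr_ge0// addr_ge0// mulr_ge0// ltW// (lt_trans _ e1).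
have Z0 : 0 < X `^ (p - 1) * Y by rewrite mulr_gt0 ?powR_gt0.
pose Z := X `^ (p - 1) * Y; exists (Z `^ (- p^-1)); first exact: powR_gt0.
split=> //; set k := Z `^ _.
have k0 : 0 < k by exact: powR_gt0.
have kp : k * k `^ (p - 1) = Z^-1.
  rewrite mulr_powRB1 ?(ltW k0)// ?(lt_trans _ p1)// /k -powRrM mulNr mulVf.
    by rewrite powR_inv1// ltW.
  by rewrite gt_eqF// (lt_trans _ p1).
rewrite powRM ?(ltW X0) ?(ltW k0)// (_ : k * _ * Y = k * k `^ (p - 1) * Z).
  by rewrite kp mulVf// gt_eqF.
by rewrite /Z; ring.
Qed.

(** With tau = th^(1 / (th p)) one has tau^(-th p) = 1 / th, and the last right-hand
    side is k / 2 times th^(-1/p) (2^(1-th) - 1), unbounded as th tends to 0. *)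
Lemma exists_singular_parameters (p k L M0 : R) : 1 < p -> 0 < k -> 0 < L -> 0 < M0 ->
  exists th tau : R,
    [/\ 0 < th, th * p <= 1, 0 < tau, tau <= 1 & th * tau `^ (- (th * p)) <= 1] /\
    (M0 <= (2 * tau)^-1 /\
    L <= k * (2 * tau)^-1 * ((tau + tau) `^ (1 - th) - tau `^ (1 - th))).
Proof.
move=> p1 k0 L0 M00; have p0 : 0 < p by rewrite (lt_trans _ p1).
pose th := Num.min (2 * p)^-1 (Num.min (2 * M0)^-1 ((k / (8 * L)) `^ p)).
have th0 : 0 < th by rewrite !lt_min !invr_gt0 !mulr_gt0//= powR_gt0// divr_gt0// mulr_gt0.
have [tha thb thc] : [/\ th <= (2 * p)^-1, th <= (2 * M0)^-1 & th <= (k / (8 * L)) `^ p].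
  by split; rewrite /th !ge_min lexx ?orbT.
have th2p : th * (2 * p) <= 1 by rewrite -ler_pdivlMr ?mulr_gt0// mul1r.
have thp : th * p <= 1 by nra.
have th2 : th <= 2^-1 by nra.
have th1 : th <= 1 by lra.
have thp0 : 0 < th * p by rewrite mulr_gt0.
pose tau := th `^ (th * p)^-1.
have tau0 : 0 < tau by exact: powR_gt0.
have tau_th : tau <= th.
  by apply: ge1r_powR; rewrite ?th0// -[leLHS]invr1 lef_pV2 ?posrE.
exists th, tau; split; first split => //.
- exact: le_trans th1.
- rewrite /tau -powRrM mulrN mulVf ?gt_eqF// powR_inv1 ?(ltW th0)//.
  by rewrite divff// gt_eqF.
split.
  rewrite -[leLHS]invrK lef_pV2 ?posrE ?invr_gt0 ?mulr_gt0//.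
  have : th * (2 * M0) <= 1 by rewrite -ler_pdivlMr ?mulr_gt0// mul1r.
  by move=> h; rewrite -[leRHS]mul1r ler_pdivlMr//; nra.
have -> : (tau + tau) `^ (1 - th) = 2 `^ (1 - th) * tau `^ (1 - th).
  by rewrite -powRM ?(ltW tau0)//; congr (powR _ _); ring.
have tauE : tau `^ (1 - th) = tau * tau `^ (- th).
  by rewrite powRD ?powRr1 ?(ltW tau0)// (gt_eqF tau0) implybT.
have tth : tau `^ (- th) = (th `^ p^-1)^-1.
  rewrite /tau -powRrM mulrN powRN; congr (_^-1); congr (powR _ _).
  by rewrite invfM mulrAC mulVf ?mul1r// gt_eqF.
have two : 5 / 4 <= 2 `^ (1 - th) :> R.
  apply: (@le_trans _ _ (2 `^ 2^-1)).
    rewrite powR12_sqrt// -[leLHS]ger0_norm; last lra.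
    by rewrite -sqrtr_sqr ler_sqrt; lra.
  by apply: ler_powR; lra.
have rt : 8 * L / k <= tau `^ (- th).
  rewrite tth -[leLHS]invrK lef_pV2 ?posrE ?invr_gt0 ?powR_gt0 ?divr_gt0 ?mulr_gt0//.
  rewrite invf_div; have -> : k / (8 * L) = ((k / (8 * L)) `^ p) `^ p^-1.
    by rewrite -powRrM divff ?gt_eqF// powRr1// ltW// divr_gt0// mulr_gt0.
  by apply: ge0_ler_powR; rewrite ?nnegrE ?invr_ge0 ?powR_ge0 ?(ltW p0) ?(ltW th0).
rewrite tauE; set T := tau `^ (- th) in rt *; set W := 2 `^ (1 - th) in two *.
rewrite (_ : k * (2 * tau)^-1 * _ = k * 2^-1 * (T * (W - 1))); last first.
  by field; rewrite gt_eqF.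
have T0 : 0 < T by exact: powR_gt0.
rewrite ler_pdivrMr// in rt.
nra.
Qed.

Section geometry.
Context {n : nat}.
Local Notation V := 'rV[R]_n.+1.

(** The ball of radius M about this point is at distance 1/2 from the boundary. *)
Definition center (M : R) : V := \row_i (if i == ord_max then M + 2^-1 else 0).
Definition test_box : set V := cbox (fun i => if i == ord_max then 1 else 0)
  (fun i => if i == ord_max then 2 else 1).

Lemma coord_rescale M (c x : V) i : rescale M c x ord0 i = M^-1 * (x ord0 i - c ord0 i).
Proof. by rewrite !mxE. Qed.

Lemma depth_support M m (c x : V) : 0 < M -> 0 < depth M m c x ->
  obox (fun i => c ord0 i - M) (fun i => c ord0 i + M) x.
Proof.
move=> M0; rewrite /depth subr_gt0 => h i.
have r1 : rescale_sq M c x < 1.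
  by rewrite ltNge; apply/negP => /(exprn_ege1 m.+1); rewrite leNgt h.
have : `|rescale M c x ord0 i| < 1.
  apply: le_lt_trans (le_coord_enorm _ _) _.
  by rewrite -sqrtr1 /enorm ltr_sqrt.
rewrite coord_rescale normrM gtr0_norm ?invr_gt0// mulrC ltr_pdivrMr// mul1r.
by rewrite ltr_distl.
Qed.

Lemma center_halfspace M :
  cbox (fun i => center M ord0 i - M) (fun i => center M ord0 i + M) `<=` (@halfspace R n).
Proof.
move=> x /(_ ord_max); rewrite mxE eqxx => /andP[+ _]; rewrite /halfspace /=; lra.
Qed.

(** On the test box M^2 |y|^2 <= (M - 1/2)^2 + n + 1, which is at most
    M^2 - M / 2 when M >= 2 n + 3. *)
Lemma depth_test_box M m x : 2 * n%:R + 3 <= M -> test_box x ->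
  (2 * M)^-1 <= depth M m (center M) x.
Proof.
move=> MN xQ; have n0 : (0 : R) <= n%:R by exact: ler0n.
have M0 : 0 < M by lra.
set r := rescale_sq M (center M) x.
have r0 : 0 <= r by exact: rescale_sq_ge0.
suff r1 : r <= 1 - (2 * M)^-1.
  have i0 : 0 < (2 * M)^-1 by rewrite invr_gt0 mulr_gt0.
  have : r ^+ m.+1 <= r by rewrite exprS; apply: ler_piMr => //; apply: exprn_ile1 => //; lra.
  by rewrite /depth -/r; lra.
have -> : 1 - (2 * M)^-1 = (M ^+ 2 - M / 2) / M ^+ 2 by field; rewrite gt_eqF.
rewrite ler_pdivlMr ?exprn_gt0//.
have rE : r * M ^+ 2 = \sum_i (x ord0 i - center M ord0 i) ^+ 2.
  rewrite /r /rescale_sq /dotv mulr_suml; apply: eq_bigr => i _.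
  by rewrite coord_rescale; field; rewrite gt_eqF.
rewrite rE (bigD1 ord_max)//=.
have h1 : (x ord0 ord_max - center M ord0 ord_max) ^+ 2 <= (M - 2^-1) ^+ 2.
  have := xQ ord_max; rewrite eqxx mxE eqxx; set t := x ord0 ord_max => /andP[t1 t2].
  rewrite -subr_ge0 (_ : _ - _ = (2 * M - t) * (t - 1)); last by field.
  by rewrite mulr_ge0//; lra.
have h2 : \sum_(i < n.+1 | i != ord_max) (x ord0 i - center M ord0 i) ^+ 2 <= n.+1%:R.
  apply: (@le_trans _ _ (\sum_(i < n.+1) 1)); last by rewrite sumr_const card_ord.
  rewrite [leRHS](bigD1 ord_max)//= ler_wpDl//; apply: ler_sum => i im.
  have := xQ i; rewrite mxE (negbTE im) subr0 => /andP[? ?]; nra.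
apply: (le_trans (lerD h1 h2)); rewrite -[n.+1]addn1 natrD; nra.
Qed.

Lemma test_box_measure : @lebesgue_rV R n.+1 test_box = 1%E.
Proof.
pose a : V := \row_i (if i == ord_max then 1 else 0).
pose b : V := \row_i (if i == ord_max then 2 else 1).
rewrite (_ : test_box = [set v : V | forall i, a ord0 i <= v ord0 i <= b ord0 i]).
  rewrite lebesgue_rV_box; last by move=> i; rewrite !mxE; case: ifP => _; lra.
  by rewrite big1// => i _; rewrite !mxE; case: ifP => _; ring.
by apply/seteqP; split => v H i; have := H i; rewrite !mxE.
Qed.

End geometry.
End parameters.

Theorem theorem3 (R : realType) (n : nat) (p : R)
    (hN : (2 <= n.+1)%N) (hp : 1 < p < n.+1%:R) :
  ~ exists u : 'rV[R]_n.+1 -> R,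
      weak_solution p u /\
      exists2 lam : R, 0 < lam & Lp (strip lam) +oo%E u.
Proof.
move=> [u [wu _]]; have /andP[p1 _] := hp.
have [m [k k0 [e1 kC]]] := exists_exponent_scale n.+1 p1.
pose mu := @lebesgue_rV R n.+1.
have large (j : nat) : {ae mu, forall x, test_box x -> j.+1%:R <= u x}.
  have n0 : (0 : R) <= n%:R by exact: ler0n.
  have [||th [tau [[th0 thp tau0 tau1 thtau] [M0 HL]]]] :=
    @exists_singular_parameters R p k j.+1%:R (2 * n%:R + 3) p1 k0; [by []|lra|].
  set M := (2 * tau)^-1 in M0 HL.
  have Mgt0 : 0 < M by rewrite invr_gt0 mulr_gt0.
  have := barrier_le_solution p1 th0 thp tau0 tau1 thtau Mgt0 k0 e1 kC wu
    (@center_halfspace R n M) (fun x => depth_support Mgt0).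
  apply: filterS => x bx xQ.
  have pf : tau <= depth M m (center M) x.
    by have := depth_test_box m M0 xQ; rewrite /M invfM invrK mulrA mulVf ?mul1r.
  have pf0 : 0 < depth M m (center M) x by exact: lt_le_trans pf.
  apply: le_trans (bx pf0); apply: le_trans HL _.
  have th1 : th < 1 by rewrite (lt_le_trans _ thp)// ltr_pMr.
  rewrite /barrier softshift_pos ?(ltW pf0)//; apply: ler_wpM2l.
    by rewrite mulr_ge0 ?(ltW k0) ?(ltW Mgt0).
  rewrite lerD2r; have h1 := addr_ge0 (ltW tau0) (ltW tau0).
  have h2 := addr_ge0 (ltW pf0) (ltW tau0).
  by apply: ge0_ler_powR; rewrite ?nnegrE ?lerD2r ?subr_ge0 ?(ltW th1).
(* A point of the box outside the exceptional sets exists, as the box has measure 1. *)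
have : {ae mu, forall x, forall j : nat, test_box x -> j.+1%:R <= u x}.
  exact: ae_foralln.
move=> [N [mN N0 subN]].
have : (mu test_box <= mu N)%E.
  apply: le_measure; rewrite ?inE//; first exact: measurable_cbox.
  move=> x xQ; apply: subN => /= H.
  have := H (Num.truncn (u x)) xQ; rewrite leNgt => /negP; apply.
  by rewrite truncnS_gt.
by rewrite N0 /mu test_box_measure lee_fin ler10.
Qed.
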